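(* Let $\dot x=f(x)$, $x\in\mathbb{R}^n$, be a polynomial system with flow $\Phi^t$, let $K\subset\mathbb{R}^n$ be a compact set and $\mu$ a probability measure on $K$, and suppose that conditions (A1), (A2), (A3) listed in the context hold. Then there exists an invariant set $X_0\subset K$ with $\mu(X_0)=1$ such that for every $x\in X_0$: (i) for every affine hyperplane $H\subset\mathbb{R}^n$, $\displaystyle\lim_{\varepsilon\to0}\limsup_{T\to\infty}\frac1T\int_0^T\mathbf 1_{U_\varepsilon(H)}(\Phi^t x)\,dt=0$, where $U_\varepsilon(H)=\{y\in K:\operatorname{dist}(y,H)<\varepsilon\}$; and (ii) consequently, the trajectory $z(t)=\Phi^t(x)$, $t\ge0$, is affinely integrally exciting, i.e. $$\liminf_{T\to\infty}\frac1T\int_0^T\phi_z(t)\phi_z(t)^\top\,dt>0,\qquad \phi_z(t)=\begin{bmatrix}z(t)\\1\end{bmatrix}\in\mathbb{R}^{n+1}.$$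
   Context: Setting. $f=f_\xi:\mathbb{R}^n\to\mathbb{R}^n$ is a vector field with polynomial components $f_i(x)=\sum_j\xi_{ij}p_{ij}(x)$ (finite sums), where the $p_{ij}$ are monomials and $\xi=(\xi_{ij})\in\Xi\subset\mathbb{R}^m$ is a fixed parameter; $\Phi^t$ denotes the flow of $\dot x=f(x)$. For a vector-valued polynomial map $g$, $L_f g(x)=Dg(x)f(x)$ is the (componentwise) Lie derivative along $f$, and $L_f^k$ is its $k$-fold iterate ($L_f^0 g=g$). Conditions: (A1) $K\subset\mathbb{R}^n$ is compact and invariant: for points of $K$ the flow is defined for all $t\in\mathbb{R}$ and $\Phi^t(K)\subset K$ for all $t\in\mathbb{R}$. (A2) $\mu$ is a $\Phi^t$-invariant probability measure on $K$ that is absolutely continuous with respect to Lebesgue measure, $d\mu=\rho(x)\,dx$, with constants $c,C$ such that $0<c\le\rho(x)\le C<\infty$ on $K$. (A3) For the $n\times n$ matrix $M(x)=[f(x)\mid L_f f(x)\mid\dots\mid L_f^{n-1}f(x)]$ (columns) and the polynomial $Q(x)=\det M(x)$, there exists a point $x_*\in K$ with $Q(x_* )\neq0$. A set $X_0\subset K$ is invariant if $\Phi^t(X_0)\subset X_0$ for all $t\in\mathbb{R}$. $\operatorname{dist}$ is Euclidean distance and $\mathbf 1_A$ is the indicator function of $A$. Affine integral excitation. For a measurable bounded trajectory $z:[0,\infty)\to\mathbb{R}^n$, put $\phi_z(t)=(z(t),1)^\top\in\mathbb{R}^{n+1}$ and $G_T=\frac1T\int_0^T\phi_z(t)\phi_z(t)^\top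 dt$. The trajectory is called affinely integrally exciting if there is $\alpha>0$ with $\liminf_{T\to\infty}G_T>\alpha I_{n+1}>0$, where the matrix inequality is understood in the sense of quadratic forms: there is $\alpha>0$ such that for every $u=(a,b)\in\mathbb{R}^n\times\mathbb{R}$ with $\|a\|^2+b^2=1$, $$\liminf_{T\to\infty}u^\top G_Tu=\liminf_{T\to\infty}\frac1T\int_0^T|a\cdot z(t)+b|^2\,dt>\alpha .$$ *)

(* Defs.v *)
From HB Require Import structures.
From mathcomp Require Import all_boot all_order all_algebra.
From mathcomp.multinomials Require mpoly.
(* The notations of mpoly clash with those of MathComp-Analysis: [mpoly n R]
   is the ring {mpoly R[n]}, [meval v p] is p.@[v], [mderiv j p] is p^`M(j). *)
Import -(notations) mpoly.
From mathcomp Require Import all_classical all_reals all_analysis.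
From mathcomp Require Import measurable_realfun.
Import Order.TTheory GRing.Theory Num.Theory.
Import numFieldNormedType.Exports.

Set Implicit Arguments.
Unset Strict Implicit.
Unset Printing Implicit Defensive.

Local Open Scope classical_set_scope.
Local Open Scope ring_scope.

(* R^n is 'rV[R]_n with its Borel sigma-algebra. *)
HB.instance Definition _ (R : realType) (n : nat) :=
  Measurable.copy 'rV[R]_n (g_sigma_algebraType (@open 'rV[R]_n)).

Section lebesgue_measure_rV.
Context {R : realType}.

Definition glue_rV (n : nat) (p : measurableTypeR R * 'rV[R]_n) :
    'rV[R]_n.+1 :=
  row_mx (p.1 : R)%:M p.2.

Fixpoint lebesgue_rV (n : nat) : set 'rV[R]_n -> \bar R :=
  match n with
  | 0%N => \d_(0 : 'rV[R]_0)
  | n'.+1 => pushforward (lebesgue_measure \x @lebesgue_rV n')%E (@glue_rV n')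
  end.

Lemma rV_open_measurable n (U : set 'rV[R]_n) : open U -> measurable U.
Proof. by move=> oU; exact: sub_sigma_algebra. Qed.

Lemma glue_rV0 n (p : R * 'rV[R]_n) : glue_rV p ord0 ord0 = p.1.
Proof.
rewrite (_ : ord0 = lshift n (ord0 : 'I_1)) ?[LHS]row_mxEl ?mxE ?eqxx//.
exact: val_inj.
Qed.

Lemma glue_rVS n (p : R * 'rV[R]_n) (j : 'I_n) :
  glue_rV p ord0 (lift ord0 j) = p.2 ord0 j.
Proof.
rewrite (_ : lift ord0 j = rshift 1 j) ?[LHS]row_mxEr//.
exact: val_inj.
Qed.

Lemma ball_glue_rV n (p q : R * 'rV[R]_n) (e : R) :
  ball (glue_rV p) e (glue_rV q) <-> ball p.1 e q.1 /\ ball p.2 e q.2.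
Proof.
split=> [[e0 h]|[pq1 [e0 pq2]]].
  split; first by have := h ord0 ord0; rewrite !glue_rV0.
  by split=> // i j; rewrite !ord1; have := h ord0 (lift ord0 j);
    rewrite !glue_rVS.
split=> // i j; rewrite !ord1; case: (unliftP ord0 j) => [k|] ->.
  by rewrite !glue_rVS; exact: pq2.
by rewrite !glue_rV0.
Qed.

Lemma measurable_glue_rV n :
  measurable_fun setT (@glue_rV n).
Proof.
apply: (@measurability _ _ _ _ _ _ (@open 'rV[R]_n.+1)) => //.
move=> _ [U oU <-]; rewrite setTI.
pose B (t : rat * 'rV[rat]_n * nat) : set (R * 'rV[R]_n) :=
  ball (ratr t.1.1 : R) t.2.+1%:R^-1 `*`
  ball (map_mx ratr t.1.2 : 'rV[R]_n) t.2.+1%:R^-1.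
rewrite (_ : _ @^-1` _ = \bigcup_t
    (if `[< B t `<=` @glue_rV n @^-1` U >] then B t else set0)); last first.
  apply/seteqP; split=> [[x v] /= Uxv|p [t _]]; last first.
    by case: asboolP => // h /h.
  have [e /= e0 eU] : exists2 e : R, 0 < e & ball (glue_rV (x, v)) e `<=` U.
    by move: oU; rewrite openE => /(_ _ Uxv) /nbhs_ballP[e e0 eU]; exists e.
  have e20 : 0 < e / 2 by rewrite divr_gt0.
  have [k _ /(_ k (leqnn _)) /= ke] := near_infty_natSinv_lt (PosNum e20).
  have k0 : (0 : R) < k.+1%:R^-1 by rewrite invr_gt0.
  have apx (y : R) : exists q : rat, ball (ratr q : R) k.+1%:R^-1 y.
    have /rat_in_itvoo[q] : y - k.+1%:R^-1 < y + k.+1%:R^-1.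
      by rewrite ltrBlDr -addrA ltrDl addr_gt0.
    rewrite in_itv /= => /andP[q1 q2]; exists q.
    by rewrite /ball /= ltr_distl q1.
  have [r rx] := apx x.
  have [q qv] := choice (fun j => apx (v ord0 j)).
  exists (r, \row_j q j, k) => //.
  have Bxv : B (r, \row_j q j, k) (x, v).
    by split=> //=; split=> // i j; rewrite !ord1 !mxE; exact: qv.
  case: asboolP => // -[] [y w] [/= ry qw]; apply: eU.
  apply/ball_glue_rV; case: Bxv => /= rx' qv'.
  have sum : k.+1%:R^-1 + k.+1%:R^-1 <= e :> R.
    by rewrite [leRHS]splitr lerD // ltW.
  by split; apply: le_ball sum _ _;
    [exact: ball_triangle (ball_sym rx') ry|
     exact: ball_triangle (ball_sym qv') qw].
apply: countable_bigcupT_measurable => [|t]; first exact: countableP.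
case: asboolP => _ //; apply: measurableX.
  exact: measurable_ball.
by apply: rV_open_measurable; exact: ball_open.
Qed.

Lemma ball_sigma_finite n (m : set 'rV[R]_n -> \bar R) :
  (forall k : nat, (m (ball (0%R : 'rV[R]_n) k.+1%:R) < +oo)%E) ->
  sigma_finite setT m.
Proof.
move=> mfin; exists (fun k => ball (0 : 'rV[R]_n) k.+1%:R).
  apply/esym/seteqP; split=> // v _; exists (Num.truncn `|v|) => //.
  by rewrite mx_norm_ball /ball_ /= sub0r normrN real_truncnS_gt.
by move=> k; split=> //; apply: rV_open_measurable; exact: ball_open.
Qed.

Let ball_finite n (m : {measure set 'rV[R]_n -> \bar R})
  (_ : forall k : nat, (m (ball (0%R : 'rV[R]_n) k.+1%:R) < +oo)%E) :
  set 'rV[R]_n -> \bar R := m.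

HB.instance Definition _ n m h := Measure.on (@ball_finite n m h).

HB.instance Definition _ n m h :=
  Measure_isSigmaFinite.Build _ _ _ (@ball_finite n m h) (ball_sigma_finite h).

Let lebesgue_rV_measure n :
  exists2 m : {measure set 'rV[R]_n -> \bar R}, lebesgue_rV (n := n) = m &
    forall k : nat, (m (ball (0%R : 'rV[R]_n) k.+1%:R) < +oo)%E.
Proof.
elim: n => [|n [m mE mfin]].
  by exists (\d_(0 : 'rV[R]_0)) => // k; rewrite /= diracE; case: (_ \in _);
    rewrite ltry.
pose m' : {sigma_finite_measure set 'rV[R]_n -> \bar R} := ball_finite mfin.
pose P : {measure set (measurableTypeR R * 'rV[R]_n) -> \bar R} :=
  (lebesgue_measure \x m')%E.
unshelve eexists (pushforward P (@glue_rV n)); first exact: measurable_glue_rV.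
  by rewrite /= mE.
move=> k; rewrite /= /pushforward.
rewrite (_ : _ @^-1` _ =
    ball (0 : R) k.+1%:R `*` ball (0 : 'rV[R]_n) k.+1%:R); last first.
  have -> : 0 = glue_rV (0 : R, 0 : 'rV[R]_n).
    apply/rowP => j; case: (unliftP ord0 j) => [i|] ->.
      by rewrite glue_rVS !mxE.
    by rewrite glue_rV0 mxE.
  apply/seteqP; split=> p /= h; first by have /ball_glue_rV := h.
  exact: (ball_glue_rV (0 : R, 0 : 'rV[R]_n) p _).2 h.
rewrite product_measure1E; [|exact: measurable_ball|
  by apply: rV_open_measurable; exact: ball_open].
rewrite [X in (X * _)%E](lebesgue_measure_ball (0 : R) (ler0n R k.+1)).
by apply: lte_mul_pinfty => //; exact: (mfin k).
Qed.

Lemma lebesgue_rV_ball n (k : nat) :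
  (lebesgue_rV (ball (0%R : 'rV[R]_n) k.+1%:R) < +oo)%E.
Proof. by have [m -> ] := lebesgue_rV_measure n. Qed.

Let lebesgue_rV0 n : lebesgue_rV (set0 : set 'rV[R]_n) = 0%E.
Proof. by have [m -> _] := lebesgue_rV_measure n; rewrite measure0. Qed.

Let lebesgue_rV_ge0 n (A : set 'rV[R]_n) : (0 <= lebesgue_rV A)%E.
Proof. by have [m -> _] := lebesgue_rV_measure n. Qed.

Let lebesgue_rV_sigma_additive n : semi_sigma_additive (@lebesgue_rV n).
Proof.
by have [m -> _] := lebesgue_rV_measure n; exact: measure_semi_sigma_additive.
Qed.

HB.instance Definition _ n := isMeasure.Build _ _ _ (@lebesgue_rV n)
  (@lebesgue_rV0 n) (@lebesgue_rV_ge0 n) (@lebesgue_rV_sigma_additive n).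

HB.instance Definition _ n := Measure_isSigmaFinite.Build _ _ _ (@lebesgue_rV n)
  (ball_sigma_finite (@lebesgue_rV_ball n)).

End lebesgue_measure_rV.

Lemma measurable_coord_rV (R : realType) (n : nat) (i : 'I_n) :
  measurable_fun setT (fun v : 'rV[R]_n => v ord0 i).
Proof.
apply: (measurability _ (RGenOpens.measurableE R)).
move=> _ [_ [a [b ->]] <-]; rewrite setTI; apply: rV_open_measurable.
apply: open_comp => [v _|]; first exact: coord_continuous.
exact: interval_open.
Qed.

Lemma lebesgue_rV_box (R : realType) (n : nat) (A : 'I_n -> set R) :
  (forall i, measurable (A i)) ->
  lebesgue_rV [set v : 'rV[R]_n | forall i, A i (v ord0 i)] =
  (\prod_(i < n) lebesgue_measure (A i))%E.
Proof.
elim: n A => [|n IHn] A mA.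
  rewrite big_ord0 /= diracE; congr (_%:E); rewrite mem_set//=.
  by case.
rewrite big_ord_recl /= /pushforward.
rewrite (_ : _ @^-1` _ = A ord0 `*`
    [set v : 'rV[R]_n | forall i, A (lift ord0 i) (v ord0 i)]); last first.
  apply/seteqP; split=> [p /= h|p /= [h0 hS] i].
    split=> [|i]; first by rewrite -(glue_rV0 p); exact: h.
    by rewrite -glue_rVS; exact: h.
  case: (unliftP ord0 i) => [j|] ->; first by rewrite glue_rVS; exact: hS.
  by rewrite glue_rV0.
rewrite product_measure1E; [|exact: mA|].
  by congr (_ * _)%E; exact: (IHn (fun i => A (lift ord0 i))).
rewrite (_ : mkset _ = \bigcap_(i in [set: 'I_n])
    ((fun v : 'rV[R]_n => v ord0 i) @^-1` A (lift ord0 i))).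
  apply: fin_bigcap_measurable => // i _; rewrite -[X in measurable X]setTI.
  exact: measurable_coord_rV.
by apply/seteqP; split=> v /= h i => [_|]; exact: h.
Qed.

Section dynamics.
Context {R : realType} {n : nat}.
Implicit Types (f g : 'I_n -> mpoly n R) (x y : 'rV[R]_n) (K H : set 'rV[R]_n)
  (Phi : R -> 'rV[R]_n -> 'rV[R]_n).

Definition poly_map_at f x : 'rV[R]_n := \row_i meval (x ord0) (f i).

Definition lie f g : 'I_n -> mpoly n R :=
  fun i => \sum_(j < n) mderiv j (g i) * f j.

Definition krylov_mx f : 'M[mpoly n R]_n :=
  \matrix_(i < n, k < n) iter k (lie f) f i.

Definition krylov_det f : mpoly n R := \det (krylov_mx f).

(* A polynomial field need not be complete, so the flow is only prescribed at
   the points of K; there it is unique, f being locally Lipschitz. *)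
Definition is_flow_on K f Phi : Prop :=
  forall x, K x -> Phi 0 x = x /\
    forall t : R, is_derive t 1 (Phi^~ x) (poly_map_at f (Phi t x)).

Definition flow_invariant Phi K : Prop := forall t : R, Phi t @` K `<=` K.

Definition invariant_measure_on K Phi (mu : set 'rV[R]_n -> \bar R) : Prop :=
  forall (t : R) (A : set 'rV[R]_n), measurable A ->
    mu (K `&` Phi t @^-1` A) = mu A.

Definition bounded_density_on K (mu : set 'rV[R]_n -> \bar R) : Prop :=
  exists (rho : 'rV[R]_n -> R) (c C : R),
    [/\ measurable_fun K rho,
        0 < c,
        forall x, K x -> c <= rho x <= C &
        forall A : set 'rV[R]_n, measurable A ->
          mu A = (\int[@lebesgue_rV R n]_(x in A `&` K) (rho x)%:E)%E].

Definition enorm x : R := Num.sqrt (\sum_(i < n) x ord0 i ^+ 2).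

Definition edist x H : R := inf [set enorm (x - y) | y in H].

Definition affine_hyperplane H : Prop :=
  exists (a : 'rV[R]_n) (b : R), a != 0 /\
    H = [set y | \sum_(i < n) a ord0 i * y ord0 i = b].

Definition hyperplane_nbhd K H (eps : R) : set 'rV[R]_n :=
  [set y | K y /\ edist y H < eps].

Definition time_avg (g : R -> R) (T : R) : R :=
  T^-1 * \int[lebesgue_measure]_(t in `[0, T]) g t.

(* Vectors are rows, so the column-vector product phi phi^T reads phi^T phi. *)
Definition augment x : 'rV[R]_(n + 1) := row_mx x 1%:M.

Definition excitation_mx (z : R -> 'rV[R]_n) (T : R) : 'M[R]_(n + 1) :=
  \matrix_(i, j)
    time_avg (fun t => ((augment (z t))^T *m augment (z t)) i j) T.

Definition affinely_integrally_exciting (z : R -> 'rV[R]_n) : Prop :=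
  [/\ measurable_fun (`[0, +oo[ : set R) z,
      exists B : R, forall t, 0 <= t -> enorm (z t) <= B &
      exists2 alpha : R, 0 < alpha &
        forall (a : 'rV[R]_n) (b : R), enorm a ^+ 2 + b ^+ 2 = 1 ->
        let u := row_mx a b%:M in
        (alpha%:E < limf_einf (fun T : R =>
           ((u *m excitation_mx z T *m u^T) ord0 ord0)%:E) +oo%R)%E].

End dynamics.

(* Main.v *)
(* Let Q = det [f | L_f f | ... | L_f^(n-1) f].  At a point with |Q| >= d, some
   derivative of order at most n of t |-> a.z(t) + b is bounded below in terms of
   d and a alone, so on a short time block starting there the orbit spends
   arbitrarily little time in a thin neighbourhood of a hyperplane, uniformly in
   the hyperplane.  It remains to bound the frequency of visits to {|Q| < d}
   along the orbit.  A maximal inequality for the flow at discrete times bounds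
   it, off a set of small measure, by a multiple of mu {|Q| < d}, which tends to
   0 with d since the zero set of the nonzero polynomial Q is Lebesgue null.  No
   convergence of ergodic averages is needed. *)
Require Import Defs.
From mathcomp Require Import all_boot all_order all_algebra.
From mathcomp.multinomials Require mpoly.
Import -(notations) mpoly.
From mathcomp Require Import all_classical all_reals all_analysis.
From mathcomp Require Import measurable_realfun.
From mathcomp Require Import lra ring.
Import Order.TTheory GRing.Theory Num.Theory.
Import numFieldNormedType.Exports.

Local Open Scope classical_set_scope.
Local Open Scope ring_scope.
Set Implicit Arguments.
Unset Strict Implicit.
Unset Printing Implicit Defensive.

(** * Polynomial functions *)

(** Two scales have to be matched. A derivative that is bounded below at one instant keeps that
    bound only for a time proportional to it, so the threshold for |Q| and the block length shrink
    together: d = th * [step k], with th determined by f and K. A block is then judged by its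
    starting point alone, and the visits to count are those of a discretely sampled orbit.

    Refining the step gives infinitely many chances: for a given frequency 1/(l+1) and a given th,
    the exceptional points are those that fail for every k, and their measure is below every term of
    a sequence tending to 0. Only countably many pairs (l, th) occur, so the union of these null
    sets is null.

    The offset b disappears on differentiation, which gives uniformity in b; uniformity in a holds
    as long as a stays away from 0. Part (ii) needs one alpha for all unit vectors (a, b), so it is
    drawn from this uniform estimate instead of from the limits in (i), which concern one hyperplane
    at a time. When a is close to 0, the offset b alone keeps a.z + b away from 0. *)

Lemma mpoly_alg_ind (R : comNzRingType) (n : nat) (P : mpoly n R -> Prop) :
  (forall c, P (mpolyC n c)) -> (forall i, P (mpolyX R (mnm1 i))) ->
  (forall p q, P p -> P q -> P (p + q)) ->
  (forall p q, P p -> P q -> P (p * q)) ->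
  forall p, P p.
Proof.
move=> PC PX PD PM; elim/mpolyind => [|c m p _ _ Pp].
  by rewrite -(mpolyC0 n R); exact: PC.
apply: (PD) => //; rewrite -mul_mpolyC; apply: (PM) => //.
rewrite mpolyXE_id; elim/big_ind: _ => [||i _].
- exact: PC.
- exact: PM.
- elim: (m i) => [|k IH]; first by rewrite expr0; exact: PC.
  by rewrite exprS; exact: PM.
Qed.

Section polynomial_functions.
Context {R : realType}.

Lemma meval_box_bounded (n : nat) (p : mpoly n R) (b : R) :
  exists2 B : R, 0 <= B & forall x : 'rV[R]_n,
    (forall i, `|x ord0 i| <= b) -> `|meval (x ord0) p| <= B.
Proof.
elim/mpoly_alg_ind: p => [c|i|p q [B B0 HB] [C C0 HC]|p q [B B0 HB] [C C0 HC]].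
- by exists `|c| => // x _; rewrite mevalC.
- have [b0|b0] := leP 0 b; first by exists b => // x hx; rewrite mevalXU.
  exists 0 => // x /(_ i) hx; have := normr_ge0 (x ord0 i); lra.
- exists (B + C); first exact: addr_ge0.
  move=> x hx; rewrite mevalD (le_trans (ler_normD _ _))// lerD//;
    [exact: HB|exact: HC].
- exists (B * C); first exact: mulr_ge0.
  move=> x hx; rewrite mevalM normrM ler_pM//; [exact: HB|exact: HC].
Qed.

Lemma meval_box_lipschitz (n : nat) (p : mpoly n R) (b : R) :
  exists2 L : R, 0 <= L & forall x y : 'rV[R]_n,
    (forall i, `|x ord0 i| <= b) -> (forall i, `|y ord0 i| <= b) ->
    `|meval (x ord0) p - meval (y ord0) p| <=
      L * \sum_i `|x ord0 i - y ord0 i|.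
Proof.
elim/mpoly_alg_ind: p => [c|i|p q [B B0 HB] [C C0 HC]|p q [B B0 HB] [C C0 HC]].
- by exists 0 => // x y _ _; rewrite !mevalC subrr normr0 mul0r.
- exists 1 => // x y _ _; rewrite !mevalXU mul1r (bigD1 i)//= lerDl.
  exact: sumr_ge0.
- exists (B + C); first exact: addr_ge0.
  move=> x y hx hy; rewrite !mevalD mulrDl opprD addrACA.
  rewrite (le_trans (ler_normD _ _))// lerD//; [exact: HB|exact: HC].
- have [B' B'0 HB'] := meval_box_bounded p b.
  have [C' C'0 HC'] := meval_box_bounded q b.
  exists (B * C' + B' * C); first by rewrite addr_ge0// mulr_ge0.
  move=> x y hx hy; rewrite !mevalM.
  have -> : meval (x ord0) p * meval (x ord0) q -
     meval (y ord0) p * meval (y ord0) q =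
     (meval (x ord0) p - meval (y ord0) p) * meval (x ord0) q +
     meval (y ord0) p * (meval (x ord0) q - meval (y ord0) q) by ring.
  rewrite (le_trans (ler_normD _ _))// [leRHS]mulrDl !normrM lerD//.
    by rewrite mulrAC ler_pM ?HB ?HC'.
  by rewrite -mulrA ler_pM ?HB' ?HC.
Qed.

Lemma measurable_meval (n : nat) (p : mpoly n R) :
  measurable_fun setT (fun x : 'rV[R]_n => meval (x ord0) p).
Proof.
elim/mpoly_alg_ind: p => [c|i|p q IHp IHq|p q IHp IHq].
- by under eq_fun do rewrite mevalC; exact: measurable_cst.
- by under eq_fun do rewrite mevalXU; exact: measurable_coord_rV.
- by under eq_fun do rewrite mevalD; exact: measurable_funD.
- by under eq_fun do rewrite mevalM; exact: measurable_funM.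
Qed.

Lemma glue_section_poly (n : nat) (p : mpoly n.+1 R) (v : 'rV[R]_n) :
  exists P : {poly R}, forall t, meval (glue_rV (t, v) ord0) p = P.[t].
Proof.
elim/mpoly_alg_ind: p => [c|i|p q [P hP] [Q hQ]|p q [P hP] [Q hQ]].
- by exists c%:P => t; rewrite mevalC hornerC.
- case: (unliftP ord0 i) => [j|] ->.
    by exists (v ord0 j)%:P => t; rewrite mevalXU hornerC glue_rVS.
  by exists 'X => t; rewrite mevalXU hornerX glue_rV0.
- by exists (P + Q) => t; rewrite mevalD hornerD hP hQ.
- by exists (P * Q) => t; rewrite mevalM hornerM hP hQ.
Qed.

Lemma glue_section_mpoly (n : nat) (p : mpoly n.+1 R) (t : R) :
  exists q : mpoly n R, forall v,
    meval (glue_rV (t, v) ord0) p = meval (v ord0) q.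
Proof.
elim/mpoly_alg_ind: p => [c|i|p q [P hP] [Q hQ]|p q [P hP] [Q hQ]].
- by exists (mpolyC n c) => v; rewrite !mevalC.
- case: (unliftP ord0 i) => [j|] ->.
    by exists (mpolyX R (mnm1 j)) => v; rewrite !mevalXU glue_rVS.
  by exists (mpolyC n t) => v; rewrite mevalXU mevalC glue_rV0.
- by exists (P + Q) => v; rewrite !mevalD hP hQ.
- by exists (P * Q) => v; rewrite !mevalM hP hQ.
Qed.

Lemma glue_rV_surj (n : nat) (x : 'rV[R]_n.+1) :
  glue_rV (x ord0 ord0, \row_j x ord0 (lift ord0 j)) = x.
Proof.
apply/rowP => i; case: (unliftP ord0 i) => [j|] ->.
  by rewrite glue_rVS mxE.
by rewrite glue_rV0.
Qed.

(** Induction on the dimension through Fubini, anchored at the point [x0]: on the line through [x0]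
    along the first coordinate, [p] is a nonzero univariate polynomial. For [t] outside its finitely
    many roots, the slice of [p] at [t] does not vanish at the tail of [x0], so the induction
    hypothesis applies to it. *)
Lemma meval_zeros_null (n : nat) (p : mpoly n R) (x0 : 'rV[R]_n) :
  meval (x0 ord0) p != 0 ->
  lebesgue_rV [set x : 'rV[R]_n | meval (x ord0) p = 0] = 0%E.
Proof.
elim: n p x0 => [|n IH] p x0 px0.
  rewrite /= diracE memNset//= => p0; move: px0.
  by rewrite (_ : x0 = 0) ?p0 ?eqxx//; apply/rowP; case.
set Z := [set x | _].
have mZ : measurable Z.
  have := measurable_meval p measurableT (measurable_set1 0).
  by rewrite setTI.
have mgZ : measurable (@glue_rV R n @^-1` Z).
  by have := measurable_glue_rV measurableT mZ; rewrite setTI.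
rewrite /= /pushforward /product_measure1.
have [P hP] := glue_section_poly p (\row_j x0 ord0 (lift ord0 j)).
have P0 : P != 0.
  apply: contraNneq px0 => P0; rewrite -(glue_rV_surj x0) hP P0 horner0.
  exact: eqxx.
pose N : set (measurableTypeR R) := [set t | root P t].
have finN : finite_set N.
  apply: contrapT => /(infinite_set_fset (size P)) [B BN sB].
  have rB : all (root P) (finmap.enum_fset B).
    by apply/allP => t tB; exact: BN.
  by have := max_poly_roots P0 rB (finmap.fset_uniq B); rewrite ltnNge sB.
have cN : countable N by exact: finite_set_countable.
have mN : measurable N by apply: countable_measurable cN => t;
  exact: measurable_set1.
have lN : lebesgue_measure N = 0%E := countable_lebesgue_measure0 cN.
rewrite (ge0_negligible_integral mN)//; last exact: measurable_fun_xsection.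
apply: integral0_eq => t [_ /negP Nt] /=.
have [q hq] := glue_section_mpoly p t.
rewrite [X in lebesgue_rV X](_ : _ = [set v : 'rV[R]_n | meval (v ord0) q = 0]).
  by apply: (IH _ (\row_j x0 ord0 (lift ord0 j))); rewrite -hq hP.
rewrite xsectionE; apply/seteqP; split=> v.
  by rewrite /Z /= hq.
by rewrite /Z /= hq.
Qed.

End polynomial_functions.

(** * Polynomial flows *)

Section dynamics.
Context {R : realType} {n : nat}.
Implicit Types (f g : 'I_n -> mpoly n R) (p : mpoly n R) (z : R -> 'rV[R]_n).

(** Scalar form of [lie]: [lie f g i] is convertible to [lie_deriv f (g i)]. *)
Definition lie_deriv f p : mpoly n R := \sum_(j < n) mderiv j p * f j.

Lemma is_derive_coord z (dz : 'rV[R]_n) (t : R) (i : 'I_n) :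
  is_derive t 1 z dz -> is_derive t 1 (fun s => z s ord0 i) (dz ord0 i).
Proof.
move=> h; have dz1 : derivable z t 1 by exact: ex_derive.
apply: DeriveDef; first exact: (derivable_mxP z t 1).1 dz1 ord0 i.
by rewrite -(@derive_val _ _ _ _ _ _ _ h) derive_mx// mxE.
Qed.

Lemma is_derive_meval f p z (t : R) :
  is_derive t 1 z (poly_map_at f (z t)) ->
  is_derive t 1 (fun s => meval (z s ord0) p)
    (meval (z t ord0) (lie_deriv f p)).
Proof.
move=> dz; elim/mpoly_alg_ind: p => [c|i|p q IHp IHq|p q IHp IHq].
- rewrite (_ : (fun _ => _) = cst c); last first.
    by apply/funext => s; rewrite mevalC.
  apply: is_derive_eq; rewrite /lie_deriv big1 ?meval0// => j _.
  by rewrite mderivC mul0r.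
- rewrite (_ : (fun _ => _) = fun s => z s ord0 i); last first.
    by apply/funext => s; rewrite mevalXU.
  apply: is_derive_eq (is_derive_coord i dz) _.
  rewrite mxE /lie_deriv (bigD1 i)//= big1 ?addr0 => [|j ji].
    rewrite mderivX mnm1E eqxx scale1r (_ : mnm_sub _ _ = mnm0).
      by rewrite mpolyX0 mul1r.
    by apply/mnmP => k; rewrite mnmBE subnn mnm0E.
  by rewrite mderivX mnm1E (eq_sym i) (negbTE ji) scale0r mul0r.
- rewrite (_ : (fun _ => _) = (fun s => meval (z s ord0) p) +
    (fun s => meval (z s ord0) q)); last first.
    by apply/funext => s; rewrite mevalD.
  apply: is_derive_eq (is_deriveD IHp IHq) _.
  rewrite -mevalD /lie_deriv -big_split/=; congr meval.
  by apply: eq_bigr => j _; rewrite mderivD mulrDl.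
- rewrite (_ : (fun _ => _) = (fun s => meval (z s ord0) p) *
    (fun s => meval (z s ord0) q)); last first.
    by apply/funext => s; rewrite mevalM.
  apply: is_derive_eq (is_deriveM IHp IHq) _.
  rewrite -![_ *: _]mevalM -mevalD /lie_deriv !mulr_sumr -big_split/=;
    congr meval.
  apply: eq_bigr => j _; rewrite mderivM.
  by rewrite mulrDl addrC !mulrA [q * _]mulrC.
Qed.

Lemma is_derive_translate z (dz : 'rV[R]_n) (t c : R) :
  is_derive (t + c) 1 z dz -> is_derive t 1 (fun s => z (s + c)) dz.
Proof.
have E : (fun h : R => h^-1 *: (((fun s => z (s + c)) \o shift t) (h *: 1) -
    z (t + c))) = fun h => h^-1 *: ((z \o shift (t + c)) (h *: 1) - z (t + c)).
  by apply/funext => h; rewrite /= addrA.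
move=> [dz1 dz2]; apply: DeriveDef.
  by move: dz1; rewrite /derivable -E.
by move: dz2; rewrite /derive -E.
Qed.

(** The hypothesis bounds [|dW|], hence survives time reversal, and the forward estimate yields both
    signs of [s]. Forward in time, [W] multiplied by [expR (- (L * t))] is nonincreasing. *)
Lemma gronwall (W dW : R -> R) (L : R) :
  (forall s, 0 <= W s) -> (forall s : R, is_derive s 1 W (dW s)) ->
  (forall s, `|dW s| <= L * W s) -> forall s, W s <= W 0 * expR (L * `|s|).
Proof.
suff nonneg (V dV : R -> R) : (forall s, 0 <= V s) ->
    (forall s : R, is_derive s 1 V (dV s)) ->
    (forall s, `|dV s| <= L * V s) ->
    forall s, 0 <= s -> V s <= V 0 * expR (L * s).
  move=> W0 dWE dWL s; have [s0|s0] := leP 0 s.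
    by rewrite ger0_norm//; apply: (nonneg W dW).
  rewrite ltr0_norm// -[in W s](opprK s) -[in W 0]oppr0.
  apply: (nonneg (fun s => W (- s)) (fun s => - dW (- s))) => //.
  - move=> t; apply: is_derive_eq (is_derive1_comp (dWE _) (is_deriveN
    (is_derive_id _ _))) _.
    by rewrite mulrN1.
  - by move=> t; rewrite normrN.
  - by rewrite oppr_ge0 ltW.
move=> V0 dVE dVL s s0.
pose U t := V t * expR (- (L * t)).
have dU (t : R) : is_derive t 1 U ((dV t - L * V t) * expR (- (L * t))).
  have dLt : is_derive t 1 (fun s => - (L * s)) (- L).
    rewrite (_ : (fun _ => _) = (- L) \*: (id : R -> R)); last first.
      by apply/funext => u; rewrite /= scaleNr.
    by apply: is_derive_eq; rewrite /= [_ *: _]mulr1.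
  have dE : is_derive t 1 (expR \o (fun s => - (L * s)))
      (expR (- (L * t)) * - L).
    exact: is_derive1_comp.
  apply: is_derive_eq (is_deriveM (dVE t) dE) _.
  rewrite [LHS](_ : _ = V t * (expR (- (L * t)) * - L) +
    expR (- (L * t)) * dV t)//; ring.
have [|c cs Uc] := @MVT_segment R U _ 0 s s0 (fun t _ => dU t).
  apply: derivable_within_continuous => t _; have := dU t => dUt;
    exact: ex_derive.
have Us0 : U s <= U 0.
  rewrite -subr_le0 Uc mulr_le0_ge0 ?subr_ge0//.
  rewrite mulr_le0_ge0 ?expR_ge0// subr_le0.
  exact: le_trans (ler_norm _) (dVL c).
by move: Us0; rewrite /U mulr0 oppr0 expR0 mulr1 expRN ler_pdivrMr ?expR_gt0.
Qed.

(** Cauchy-Schwarz against the constant vector, obtained by summing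
    [2 |d i| |d j| <= d i ^+ 2 + d j ^+ 2] over all pairs. *)
Lemma sum_norm_sqr_le (d : 'I_n -> R) :
  (\sum_i `|d i|) * (\sum_i `|d i|) <= n%:R * \sum_i d i ^+ 2.
Proof.
set S := \sum_i d i ^+ 2.
have E1 : \sum_i \sum_(j < n) d i ^+ 2 = n%:R * S.
  by rewrite mulr_sumr; apply: eq_bigr => i _;
    rewrite sumr_const card_ord mulr_natl.
have E2 : \sum_(i < n) S = n%:R * S by rewrite sumr_const card_ord mulr_natl.
have : \sum_i \sum_j (2 * (`|d i| * `|d j|)) <=
    \sum_i \sum_j (d i ^+ 2 + d j ^+ 2).
  apply: ler_sum => i _; apply: ler_sum => j _.
  rewrite -(real_normK (num_real (d i))) -(real_normK (num_real (d j))).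
  have := sqr_ge0 (`|d i| - `|d j|); nra.
under [leRHS]eq_bigr do rewrite big_split/=.
rewrite big_split/= E1 E2.
under eq_bigr do rewrite -!mulr_sumr.
rewrite -mulr_sumr -mulr_suml; lra.
Qed.

Lemma compact_rV_box (K : set 'rV[R]_n) : compact K ->
  exists2 b : R, 0 <= b & forall x, K x -> forall i, `|x ord0 i| <= b.
Proof.
move=> /compact_bounded [M [_ MK]]; exists (`|M| + 1); first exact: addr_ge0.
move=> x Kx i; have M1 : M < `|M| + 1.
  by rewrite (le_lt_trans (ler_norm M))// ltrDl.
apply: le_trans (MK _ M1 x Kx); rewrite [leRHS]/Num.Def.normr/= mx_normrE.
exact: (@le_bigmax _ _ _ 0 (fun k : 'I_1 * 'I_n => `|x k.1 k.2|) (ord0, i)).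
Qed.

Lemma field_box_lipschitz f (b : R) : exists2 L : R, 0 <= L &
  forall x y : 'rV[R]_n, (forall i, `|x ord0 i| <= b) ->
    (forall i, `|y ord0 i| <= b) -> forall i,
    `|meval (x ord0) (f i) - meval (y ord0) (f i)| <=
      L * \sum_j `|x ord0 j - y ord0 j|.
Proof.
have /choice[L HL] : forall i, exists L : R, 0 <= L /\
    forall x y : 'rV[R]_n, (forall i, `|x ord0 i| <= b) ->
    (forall i, `|y ord0 i| <= b) ->
    `|meval (x ord0) (f i) - meval (y ord0) (f i)| <=
      L * \sum_j `|x ord0 j - y ord0 j|.
  by move=> i; have [L L0 HL] := meval_box_lipschitz (f i) b; exists L.
exists (\sum_i L i); first by apply: sumr_ge0 => i _; have [] := HL i.
move=> x y hx hy i; have [_ /(_ x y hx hy)/le_trans] := HL i; apply.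
apply: ler_wpM2r; first exact: sumr_ge0.
rewrite (bigD1 i)//= lerDl; apply: sumr_ge0 => j _; by have [] := HL j.
Qed.

(** Squared Euclidean distance, which is differentiable along solutions, unlike the maximum norm
    carried by ['rV[R]_n]. *)
Definition sqdist (x y : 'rV[R]_n) : R := \sum_i (x ord0 i - y ord0 i) ^+ 2.

Lemma sqdist_ge0 x y : 0 <= sqdist x y.
Proof. by apply: sumr_ge0 => i _; exact: sqr_ge0. Qed.

Lemma solutions_sqdist_le f (b : R) : exists L : R,
  forall u v : R -> 'rV[R]_n,
    (forall t : R, is_derive t 1 u (poly_map_at f (u t))) ->
    (forall t : R, is_derive t 1 v (poly_map_at f (v t))) ->
    (forall t i, `|u t ord0 i| <= b) -> (forall t i, `|v t ord0 i| <= b) ->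
    forall t, sqdist (u t) (v t) <= sqdist (u 0) (v 0) * expR (L * `|t|).
Proof.
have [L L0 HL] := field_box_lipschitz f b.
(* The derivative of [sqdist] is twice the sum of [e i * de i], with [|de i|] at most [L] times the
   l1 norm of [e]; the factor [n] comes from bounding the square of that l1 norm by [sqdist]. *)
exists (2 * L * n%:R) => u v du dv ub vb.
pose e i t := u t ord0 i - v t ord0 i.
pose de i t := meval (u t ord0) (f i) - meval (v t ord0) (f i).
apply: (@gronwall (fun t => sqdist (u t) (v t))
    (fun t => \sum_i (e i t * de i t + e i t * de i t))) => [t|t|t].
- exact: sqdist_ge0.
- rewrite (_ : (fun _ => _) = \sum_i (e i * e i)); last first.
    apply/funext => s; rewrite fct_sumE; apply: eq_bigr => i _.
    by rewrite expr2.
  apply: is_derive_sum => i.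
  have dei : is_derive t 1 (e i) (de i t).
    have hu := is_derive_coord i (du t); have hv := is_derive_coord i (dv t).
    by move: hu hv; rewrite !mxE => hu hv; exact: is_deriveB hu hv.
  exact: (is_deriveM dei dei).
- rewrite (le_trans (ler_norm_sum _ _ _))//.
  pose S := \sum_j `|e j t|.
  apply: (@le_trans _ _ (\sum_i (2 * L * S) * `|e i t|)).
    apply: ler_sum => i _; rewrite -mulr2n normrMn normrM -mulr_natl.
    have := HL _ _ (ub t) (vb t) i; rewrite -/(de i t) -/S => h.
    have := ler_wpM2l (normr_ge0 (e i t)) h; nra.
  rewrite -mulr_sumr -!mulrA; do 2 apply: ler_wpM2l => //.
  exact: sum_norm_sqr_le (fun i => e i t).
Qed.

Lemma sqdist0_eq (x y : 'rV[R]_n) : sqdist x y <= 0 -> x = y.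
Proof.
move=> h; apply/rowP => i; apply/eqP; rewrite -subr_eq0 -sqrf_eq0 eq_le sqr_ge0.
rewrite andbT; apply: le_trans h; rewrite /sqdist (bigD1 i)//= lerDl.
by apply: sumr_ge0 => j _; exact: sqr_ge0.
Qed.

(** * The flow on the compact invariant set *)

Section flow.
Variables (f : 'I_n -> mpoly n R) (Phi : R -> 'rV[R]_n -> 'rV[R]_n).
Variable K : set 'rV[R]_n.
Hypothesis K_compact : compact K.
Hypothesis Phi_flow : is_flow_on K f Phi.
Hypothesis K_invariant : flow_invariant Phi K.

Lemma flow_in t x : K x -> K (Phi t x).
Proof. by move=> Kx; apply: (K_invariant (t := t)); exists x. Qed.

Lemma flow_sqdist_le : exists L : R, forall x y t, K x -> K y ->
  sqdist (Phi t x) (Phi t y) <= sqdist x y * expR (L * `|t|).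
Proof.
have [b b0 Kb] := compact_rV_box K_compact.
have [L HL] := solutions_sqdist_le f b; exists L => x y t Kx Ky.
have [x0 dx] := Phi_flow Kx; have [y0 dy] := Phi_flow Ky.
rewrite -{2}x0 -{2}y0; apply: HL => //.
- by move=> s i; apply: Kb; exact: flow_in.
- by move=> s i; apply: Kb; exact: flow_in.
Qed.

(** The group law is not part of [is_flow_on]; it follows from uniqueness. As functions of [s], both
    sides solve the equation inside [K] with the same value at [s = 0], so the exponential bound on
    [sqdist] starts from 0. *)
Lemma flowD s t x : K x -> Phi (s + t) x = Phi s (Phi t x).
Proof.
move=> Kx; have [b b0 Kb] := compact_rV_box K_compact.
have [L HL] := solutions_sqdist_le f b.
have Kt := flow_in t Kx.
have [x0 dx] := Phi_flow Kx; have [y0 dy] := Phi_flow Kt.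
apply: sqdist0_eq.
have du (u : R) : is_derive u 1 (fun s => Phi (s + t) x)
    (poly_map_at f (Phi (u + t) x)).
  by apply: is_derive_translate; exact: dx.
have ub (u : R) i : `|Phi (u + t) x ord0 i| <= b by apply: Kb; exact: flow_in.
have vb (u : R) i : `|Phi u (Phi t x) ord0 i| <= b by apply: Kb; exact: flow_in.
have := HL _ _ du dy ub vb s.
rewrite add0r y0 (_ : sqdist (Phi t x) _ = 0) ?mul0r//.
by rewrite /sqdist big1// => i _; rewrite subrr expr0n.
Qed.

Lemma continuous_orbit x : K x -> continuous (Phi^~ x).
Proof.
move=> Kx t; have [_ dx] := Phi_flow Kx.
by apply/differentiable_continuous/derivable1_diffP; have := dx t => ?;
  exact: ex_derive.
Qed.

Lemma continuous_within_flow t : {within K, continuous (Phi t)}.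
Proof.
have [L HL] := flow_sqdist_le.
apply/subspace_continuousP => x Kx; apply/cvgrPdist_lt => e e0.
have E1 := expR_gt0 (L * `|t|); set E := expR _ in E1.
(* [d] passes from the maximum norm, which defines balls, to [sqdist]: it ensures
   [n * d ^+ 2 * E < e ^+ 2]. The [+ 1] beside [n] covers [n = 0]. *)
pose d := e / ((n%:R + 1) * (E + 1)).
have d0 : 0 < d by rewrite divr_gt0// mulr_gt0// ?addr_gt0// ltr_wpDl.
rewrite near_withinE; near=> y => Ky.
have xyd : ball x d y by near: y; exact: nbhsx_ballx.
have xy : sqdist x y <= n%:R * d ^+ 2.
  rewrite /sqdist -[n in n%:R]card_ord mulr_natl -sumr_const.
  apply: ler_sum => i _; rewrite -(real_normK (num_real (_ - _))).
  rewrite lerXn2r ?nnegrE//; first exact: ltW.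
  by case: xyd => _ /(_ ord0 i) /ltW.
have ee : n%:R * d ^+ 2 * E < e ^+ 2.
  have -> : e = d * ((n%:R + 1) * (E + 1)).
    by rewrite /d divfK// mulf_neq0// gt_eqF// ?addr_gt0// ltr_wpDl.
  rewrite [ltRHS]exprMn mulrAC [ltLHS]mulrC ltr_pM2l ?exprn_gt0//.
  have n0 : 0 <= n%:R :> R by [].
  rewrite exprMn; nra.
have h : sqdist (Phi t x) (Phi t y) < e ^+ 2.
  by rewrite (le_lt_trans (HL _ _ _ Kx Ky))// (le_lt_trans _ ee)// ler_pM2r.
rewrite [ltLHS]/Num.Def.normr/= mx_normrE; apply: bigmax_lt => // -[i j] _ /=.
rewrite !mxE ord1 -ltr_sqr ?nnegrE// ?ltW// real_normK ?num_real//.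
apply: le_lt_trans h; rewrite /sqdist (bigD1 j)//= lerDl.
by apply: sumr_ge0 => k _; exact: sqr_ge0.
Unshelve. all: by end_near. Qed.

Lemma measurable_compact_rV : measurable K.
Proof.
rewrite -(setCK K); apply: measurableC; apply: rV_open_measurable.
by apply: closed_openC; apply: compact_closed => //; exact: norm_hausdorff.
Qed.

Lemma measurable_flow t (A : set 'rV[R]_n) : measurable A ->
  measurable (K `&` Phi t @^-1` A).
Proof.
move=> mA; have mK := measurable_compact_rV.
suff : measurable_fun K (Phi t) by apply.
apply: (@measurability _ _ _ _ _ _ (@open 'rV[R]_n)) => //.
move=> _ [U oU <-].
have /continuousP/(_ _ oU)/open_subspaceP[V oV VK] := @continuous_within_flow t.
rewrite setIC -VK; apply: measurableI => //; exact: rV_open_measurable.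
Qed.

End flow.
End dynamics.

(** * Sublevel sets *)

Section sublevel.
Context {R : realType}.

(** By the mean value theorem, two times in the interval with [|g| < e] are at most [2 * e / m]
    apart. All such times thus lie between their infimum [c] and supremum [d], and [|g|] is large on
    both remaining sides. *)
Lemma sublevel_diameter (g dg : R -> R) (a b m e : R) : 0 < m -> 0 < e -> a <=
  b ->
  (forall t : R, is_derive t 1 g (dg t)) ->
  (forall t, a < t < b -> m <= `|dg t|) ->
  exists c d : R, [/\ a <= c, c <= d, d <= b, d - c <= 2 * e / m &
    forall t, (a < t < c) || (d < t < b) -> e <= `|g t|].
Proof.
move=> m0 e0 ab dgE mdg.
pose Z := [set t | a < t < b /\ `|g t| < e].
have diam s t : Z s -> Z t -> s - 2 * e / m <= t.
  move=> [/andP[as_ sb] gs] [/andP[at_ tb] gt].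
  have [st|ts] := leP s t.
    by rewrite (le_trans _ st)// gerBl divr_ge0// ?mulr_ge0// ltW.
  have [|c cts gE] := @MVT R g dg t s ts (fun u _ => dgE u).
    apply: derivable_within_continuous => u _; have := dgE u => ?.
    exact: ex_derive.
  have cab : a < c < b.
    by move: cts; rewrite in_itv/= => /andP[tc cs];
      rewrite (lt_trans at_ tc) (lt_trans cs sb).
  rewrite lerBlDl -lerBlDr ler_pdivlMr// mulrC.
  apply: (@le_trans _ _ (`|g s - g t|)).
    have st0 : 0 <= s - t by rewrite subr_ge0 ltW.
    by rewrite gE normrM (ger0_norm st0) ler_wpM2r// mdg.
  by rewrite (le_trans (ler_normB _ _))// mulr_natl mulr2n lerD// ltW.
have [Z0|/set0P[z Zz]] := eqVneq Z set0.
  (* No time to exclude: the removed interval degenerates to the point [a]. *)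
  exists a, a; rewrite lexx subrr; split => //.
    by rewrite divr_ge0// ?mulr_ge0// ltW.
  move=> t /orP[/andP[h1 h2]|tab]; first by have := lt_trans h1 h2;
    rewrite ltxx.
  by rewrite leNgt; apply/negP => gt; have : Z t by []; rewrite Z0.
have Za t : Z t -> a <= t by case=> /andP[/ltW].
have Zb t : Z t -> t <= b by case=> /andP[_ /ltW].
have lZ : has_lbound Z by exists a => t /Za.
have uZ : has_ubound Z by exists b => t /Zb.
have iz : inf Z <= z by apply: ge_inf.
have zs : z <= sup Z by apply: ub_le_sup.
exists (inf Z), (sup Z); split.
- by apply: lb_le_inf => [|t /Za//]; exists z.
- exact: le_trans zs.
- by apply: ge_sup => [|t /Zb//]; exists z.
- rewrite lerBlDl addrC; apply: ge_sup; first by exists z.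
  move=> s Zs; rewrite addrC -lerBlDr; apply: lb_le_inf; first by exists z.
  by move=> t Zt; exact: diam.
- move=> t tcd; rewrite leNgt; apply/negP => gt.
  have [/andP[t1 t2]|/andP[t1 t2]] := orP tcd.
    have : Z t.
      split=> //; rewrite t1 (lt_le_trans t2)//.
      by rewrite (le_trans iz)//; exact: Zb.
    by move=> /(ge_inf lZ); rewrite leNgt t2.
  have : Z t.
    split=> //; rewrite t2 andbT (le_lt_trans _ t1)//.
    by rewrite (le_trans _ zs)//; exact: Za.
  by move=> /(ub_le_sup uZ); rewrite leNgt t1.
Qed.

Lemma measurable_sublevel (g : R -> R) (a b e : R) : continuous g ->
  measurable [set t | a < t < b /\ `|g t| < e].
Proof.
move=> cg; rewrite (_ : mkset _ = `]a, b[%classic `&` (fun t =>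
  `|g t|) @^-1` `]-oo, e[).
  apply: measurableI => //; rewrite -[X in measurable X]setTI.
  have : measurable_fun setT (fun t => `|g t|).
    by apply: measurableT_comp => //; exact: continuous_measurable_fun.
  by apply.
by apply/seteqP; split=> t /=; rewrite !in_itv.
Qed.

(** A sublevel estimate of van der Corput type. [e] is chosen before the functions and the interval,
    and all later uniformity in the orbit, the block and the hyperplane rests on this order. In the
    induction step, the lower bound on the derivative of [h k] makes [h k] itself large off a short
    interval, and the induction hypothesis applies on either side of it. *)
Lemma sublevel_measure_le (k : nat) (m eta : R) : 0 < m -> 0 < eta ->
  exists2 e : R, 0 < e & forall (h : nat -> R -> R) (a b : R),
    (forall j (t : R), (j < k)%N -> is_derive t 1 (h j) (h j.+1 t)) ->
    (forall t, a < t < b -> m <= `|h k t|) ->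
    (lebesgue_measure [set t | (a < t < b) /\ `|h 0%N t| < e]%R <= eta%:E)%E.
Proof.
move=> m0; elim: k m m0 eta => [|k IH] m m0 eta eta0.
  exists m => // h a b _ hm;
    rewrite (_ : mkset _ = set0) ?measure0 ?lee_fin ?ltW//.
  by rewrite -subset0 => t [/hm]; rewrite leNgt => /negP.
(* The removed interval has length at most [2 * e / m = eta / 3]; each of the two sides is allotted
   another third. *)
pose e := m * eta / 6.
have e0 : 0 < e by rewrite divr_gt0// mulr_gt0.
have eta30 : 0 < eta / 3 by rewrite divr_gt0.
have [e' e'0 He'] := IH e e0 (eta / 3) eta30.
exists e' => // h a b dh hm.
have [ba|ab] := ltP b a.
  rewrite (_ : mkset _ = set0) ?measure0 ?lee_fin ?ltW// -subset0 =>
    t [/andP[h1 h2] _].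
  by have := lt_trans (lt_trans h1 h2) ba; rewrite ltxx.
have ch : continuous (h 0%N).
  move=> t; apply/differentiable_continuous/derivable1_diffP.
  by have := dh 0%N t isT => ?; exact: ex_derive.
have dh' j (t : R) : (j < k)%N -> is_derive t 1 (h j) (h j.+1 t).
  by move=> jk; apply: dh; rewrite ltnS ltnW.
have [c [d [ac cd db dc hcd]]] := sublevel_diameter m0 e0 ab (fun t =>
  dh k t (leqnn _)) hm.
have H1 := He' h a c dh' (fun t tac => hcd t (introT orP (or_introl tac))).
have H2 := He' h d b dh' (fun t tac => hcd t (introT orP (or_intror tac))).
set S1 := [set t | (a < t < c) /\ _] in H1.
set S2 := [set t | (d < t < b) /\ _] in H2.
have mS1 : measurable S1 := measurable_sublevel _ _ _ ch.
have mS2 : measurable S2 := measurable_sublevel _ _ _ ch.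
have mS := measurable_sublevel _ _ _ ch : measurable [set t | a < t < b /\
  `|h 0%N t| < e'].
have sub : [set t | a < t < b /\ `|h 0%N t| < e'] `<=` (S1 `|` S2) `|` `[c,
  d]%classic.
  move=> t [/andP[at_ tb] ht] /=; rewrite in_itv/=.
  have [tc|ct] := ltP t c; first by left; left; split=> //; rewrite at_.
  have [dt|td] := ltP d t; first by left; right; split=> //; rewrite dt.
  by right.
have mcd : measurable (`[c, d]%classic : set R) by exact: measurable_itv.
have mU : measurable ((S1 `|` S2) `|` `[c,
  d]%classic) by do ?apply: measurableU.
apply: (@le_trans _ _ (lebesgue_measure ((S1 `|` S2) `|` `[c, d]%classic))).
  by apply: le_measure; rewrite ?inE.
have mU12 : measurable (S1 `|` S2) by exact: measurableU.
have U1 := @measureU2 _ _ _ (@lebesgue_measure R) _ _ mU12 mcd.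
have U2 := @measureU2 _ _ _ (@lebesgue_measure R) _ _ mS1 mS2.
apply: le_trans U1 _; apply: le_trans (leeD U2 (lexx _)) _.
have lcd : (lebesgue_measure `[c, d]%classic <= (eta / 3)%:E)%E.
  rewrite lebesgue_measure_itv/= lte_fin; case: ifP => _;
    last by rewrite lee_fin ltW.
  rewrite -EFinB lee_fin (le_trans dc)// /e le_eqVlt; apply/orP; left;
    apply/eqP.
  by field; rewrite gt_eqF.
apply: le_trans (leeD (leeD H1 H2) lcd) _.
by rewrite -!EFinD lee_fin le_eqVlt; apply/orP; left; apply/eqP; field.
Qed.

End sublevel.

(** * Maximal inequality *)

Section maximal_inequality.
Context {d : measure_display} {T : measurableType d} {R : realType}.
Variables (mu : probability T R) (K : set T) (S : nat -> T -> T).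
Hypothesis S_in : forall i x, K x -> K (S i x).
Hypothesis S_id : forall x, K x -> S 0 x = x.
Hypothesis S_add : forall i j x, K x -> S (i + j) x = S i (S j x).
Hypothesis mS : forall i A, measurable A -> measurable (K `&` S i @^-1` A).
Hypothesis muS : forall i A, measurable A -> mu (K `&` S i @^-1` A) = mu A.

Definition visits (B : set T) (x : T) (N : nat) : R :=
  \sum_(0 <= j < N) \1_B (S j x).

Lemma visits_ge0 B x N : 0 <= visits B x N.
Proof. by apply: sumr_ge0 => j _; rewrite indicE. Qed.

Lemma visitsD B x M N : K x ->
  visits B x (M + N) = visits B x M + visits B (S M x) N.
Proof.
move=> Kx; rewrite /visits (big_cat_nat (n := M)) ?leq_addr//=; congr (_ + _).
rewrite -{1}[M]add0n big_addn addKn; apply: eq_bigr => j _.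
by rewrite -S_add// addnC.
Qed.

Lemma visits_le B x M N : (M <= N)%N -> visits B x M <= visits B x N.
Proof.
move=> MN; rewrite /visits [leRHS](big_cat_nat (n := M))//= lerDl.
by apply: sumr_ge0 => j _; rewrite indicE.
Qed.

Lemma visits_le_length B x N : visits B x N <= N%:R.
Proof.
have -> : N%:R = \sum_(0 <= j < N) (1 : R) by rewrite sumr_const_nat subn0.
by apply: ler_sum => j _; rewrite indicE; case: (_ \in _).
Qed.

Lemma measurable_visits B N : measurable B -> measurable K ->
  measurable_fun K (fun x => visits B x N).
Proof.
move=> mB mK; rewrite /visits; apply: measurable_sum => j.
have h : measurable_fun K (\1_(K `&` S j @^-1` B) : T -> R).
  by apply: measurable_indic; exact: mS.
apply: eq_measurable_fun h => x /set_mem Kx.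
by rewrite !indicE in_setI mem_set.
Qed.

(* Greedy covering of the orbit by disjoint segments of length at most [n] on
   which the frequency of visits to [B] exceeds [lam]. *)
Lemma visits_covering (A B : set T) (lam : R) (n : nat) : 0 <= lam <= 1 ->
  (forall x, A x -> exists2 N, (0 < N <= n)%N & lam * N%:R <= visits B x N) ->
  forall L x, K x -> lam * visits A x L <= visits B x (L + n).
Proof.
move=> /andP[lam0 lam1] HA L; have [k] := ubnP L; elim: k L =>
  // k IH [|L] Lk x Kx.
  by rewrite /visits big_geq// mulr0 add0n; exact: visits_ge0.
have [Ax|nAx] := pselect (A x); last first.
  have -> : visits A x L.+1 = visits A (S 1 x) L.
    by rewrite -(add1n L) visitsD// {1}/visits big_nat1 S_id// indicE memNset
      ?add0r.
  rewrite addSn -(add1n (L + n)) visitsD//.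
  apply: le_trans (IH _ Lk _ (S_in 1 Kx)) _.
  by rewrite lerDr visits_ge0.
have [N /andP[N0 Nn] HN] := HA x Ax.
(* The last segment may overrun [L]. Its length is at most [n], which is the slack in [L + n]. *)
have [LN|NL] := leqP L.+1 N.
  apply: (@le_trans _ _ (lam * N%:R)).
    rewrite ler_wpM2l// (le_trans (visits_le_length _ _ _))// ler_nat//.
  by apply: le_trans HN _; apply: visits_le; rewrite (leq_trans Nn)// leq_addl.
have -> : L.+1 = (N + (L.+1 - N))%N by rewrite subnKC// ltnW.
have KN := S_in N Kx; rewrite -addnA visitsD// [visits B x _]visitsD// mulrDr
  lerD//.
  by apply: le_trans HN; rewrite ler_wpM2l// visits_le_length.
apply: IH => //.
by rewrite -ltnS (leq_trans _ Lk)// ltnS ltn_subrL N0.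
Qed.

Lemma integral_visits A N : measurable A -> measurable K ->
  (\int[mu]_(x in K) (visits A x N)%:E = N%:R%:E * mu A)%E.
Proof.
move=> mA mK.
have E : {in K, (fun x => (visits A x N)%:E) =1
    (fun x => \sum_(0 <= j < N) (\1_(K `&` S j @^-1` A) x)%:E)%E}.
  move=> x /set_mem Kx; rewrite sumEFin /visits; apply: congr1.
  apply: eq_bigr => j _.
  have Kj : x \in K by rewrite inE.
  by rewrite !indicE in_setI Kj.
rewrite (eq_integral _ _ E) ge0_integral_sum//.
- rewrite (eq_bigr (fun=> mu A)) => [|j _].
    by rewrite sumr_const_nat subn0 mule_natl.
  rewrite integral_indic//; last exact: mS.
  by rewrite setIC setIA setIid; exact: muS.
- by move=> j; apply/measurable_EFinP; apply: measurable_indic; exact: mS.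
Qed.

(** Integrating the covering inequality over [K] turns each visit count into a multiple of a
    measure, by invariance: [lam * L * mu A <= (L + n) * mu B] for every [L]. As [L] grows, the
    boundary term [n] becomes negligible. *)
Lemma visits_maximal_inequality_finite (A B : set T) (lam : R) (n : nat) :
  measurable K -> measurable A -> measurable B -> 0 <= lam <= 1 ->
  (forall x, A x -> exists2 N, (0 < N <= n)%N & lam * N%:R <= visits B x N) ->
  (lam%:E * mu A <= mu B)%E.
Proof.
move=> mK mA mB lam01 HA; have lam0 : 0 <= lam by case/andP: lam01.
have key (L : nat) : lam * (L%:R * fine (mu A)) <= (L + n)%:R * fine (mu B).
  rewrite -lee_fin !EFinM !fineK ?fin_num_measure//.
  rewrite -!integral_visits// -ge0_integralZl_EFin//.
  - apply: ge0_le_integral => //.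
    + by move=> x _; rewrite lee_fin mulr_ge0// visits_ge0.
    + apply/measurable_EFinP; apply: measurable_funM => //;
      exact: measurable_visits.
    + apply/measurable_EFinP; exact: measurable_visits.
    + by move=> x Kx; rewrite lee_fin; exact: visits_covering Kx.
  - by move=> x _; rewrite lee_fin visits_ge0.
  - by apply/measurable_EFinP; exact: measurable_visits.
rewrite -(fineK (fin_num_measure mu _ mA)) -(fineK (fin_num_measure mu _ mB))
  -EFinM lee_fin.
set a := fine _ in key *; set b := fine _ in key *.
rewrite leNgt; apply/negP => ba.
have b0 : 0 <= b by exact: fine_ge0.
have [L HL] : exists L : nat, n%:R * b / (lam * a - b) < L%:R.
  exists (Num.truncn (n%:R * b / (lam * a - b))).+1.
  exact: truncnS_gt.
move: HL; rewrite ltr_pdivrMr ?subr_gt0// => HL.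
have := key L; rewrite natrD; nra.
Qed.

(** The covering argument needs segments of bounded length, so the exceptional set is exhausted by
    the sets [A n] where a length at most [n] suffices, and continuity of [mu] from below concludes.
    Length 0 never qualifies, the inequality being strict. *)
Lemma visits_maximal_inequality (B : set T) (lam : R) :
  measurable K -> measurable B -> 0 <= lam <= 1 ->
  (lam%:E * mu (K `&` [set x | exists N, (lam * N%:R < visits B x N)%R]) <=
    mu B)%E.
Proof.
move=> mK mB lam01.
pose A n := K `&` [set x | exists2 N, (0 < N <=
  n)%N & lam * N%:R < visits B x N].
have mA n : measurable (A n).
  rewrite (_ : A n = \bigcup_(N in [set N | (0 < N <= n)%N])
      (K `&` (fun x => visits B x N - lam * N%:R) @^-1` `]0, +oo[%classic)).
    apply: bigcup_measurable => N _; have : measurable_fun K (fun x =>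
      visits B x N - lam * N%:R).
      by apply: measurable_funB => //; exact: measurable_visits.
    by apply.
  apply/seteqP; split=> x.
    by move=> [Kx [N N0 HN]]; exists N => //; split=> //=;
      rewrite in_itv/= subr_gt0 HN.
  move=> [N /= N0 [Kx]]; rewrite /= in_itv/= subr_gt0 andbT => HN.
  by split=> //; exists N.
have -> : K `&` [set x | exists N, lam * N%:R < visits B x N] = \bigcup_n A n.
  apply/seteqP; split=> x.
    move=> [Kx [[|N] HN]]; last by exists N.+1 => //; split=> //; exists N.+1 =>
      //; rewrite leqnn.
    by move: HN; rewrite /visits big_geq// mulr0 ltxx.
  by move=> [n _ [Kx [N _ HN]]]; split=> //; exists N.
have mU : measurable (\bigcup_n A n) by exact: bigcup_measurable.
have cA : (mu \o A) n @[n --> \oo] --> mu (\bigcup_n A n).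
  apply: nondecreasing_cvg_mu => // i j ij; apply/subsetPset =>
    x [Kx [N /andP[N0 Ni] HN]].
  by split=> //; exists N => //; rewrite N0 (leq_trans Ni).
have lamA : (lam%:E * mu (A n))%E @[n --> \oo] -->
  (lam%:E * mu (\bigcup_n A n))%E.
  by apply: cvgeZl.
rewrite -(cvg_lim _ lamA)//; apply: lime_le; first by apply/cvg_ex; eexists;
  exact: lamA.
apply: nearW => n; apply: (visits_maximal_inequality_finite (n := n)) =>
  // x [Kx [N Nn HN]].
by exists N => //; exact: ltW.
Qed.

End maximal_inequality.

(** * Regular points *)

Section excitation.
Context {R : realType} {n : nat}.
Variables (f : 'I_n -> mpoly n R) (Phi : R -> 'rV[R]_n -> 'rV[R]_n).
Variable K : set 'rV[R]_n.
Hypothesis K_compact : compact K.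
Hypothesis Phi_flow : is_flow_on K f Phi.
Hypothesis K_invariant : flow_invariant Phi K.

Let flow_K t x (Kx : K x) : K (Phi t x) := flow_in K_invariant t Kx.

(** Along an orbit, [comb a (iter k (lie f) f)] is the derivative of order [k + 1] of [affine a b];
    the offset [b] no longer appears in it. *)
Definition comb (a : 'rV[R]_n) (g : 'I_n -> mpoly n R) (x : 'rV[R]_n) : R :=
  \sum_i a ord0 i * meval (x ord0) (g i).

Definition norm1 (a : 'rV[R]_n) : R := \sum_i `|a ord0 i|.

Lemma norm1_ge0 a : 0 <= norm1 a.
Proof. exact: sumr_ge0. Qed.

Definition affine (a : 'rV[R]_n) (b : R) (x : 'rV[R]_n) : R :=
  \sum_i a ord0 i * x ord0 i + b.

Lemma is_derive_comb a g x (t : R) : K x ->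
  is_derive t 1 (fun s => comb a g (Phi s x)) (comb a (lie f g) (Phi t x)).
Proof.
move=> Kx; have [_ dx] := Phi_flow Kx.
rewrite (_ : (fun _ => _) = \sum_i (a ord0 i \*: fun s =>
  meval (Phi s x ord0) (g i))).
  by apply: is_derive_sum => i; apply: is_deriveZ; exact: is_derive_meval.
by apply/funext => s; rewrite fct_sumE.
Qed.

Lemma is_derive_affine a b x (t : R) : K x ->
  is_derive t 1 (fun s => affine a b (Phi s x)) (comb a f (Phi t x)).
Proof.
move=> Kx; have [_ dx] := Phi_flow Kx.
rewrite (_ : (fun _ => _) = \sum_i (a ord0 i \*: fun s =>
  Phi s x ord0 i) + cst b).
  rewrite -[X in is_derive _ _ _ X]addr0.
  apply: is_deriveD; apply: is_derive_sum => i; apply: is_deriveZ.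
  by have := is_derive_coord i (dx t); rewrite mxE.
by apply/funext => s; rewrite /affine fctE fct_sumE.
Qed.

Lemma meval_orbit_lipschitz (p : mpoly n R) : exists2 D : R, 0 <= D &
  forall x t s, K x ->
    `|meval (Phi t x ord0) p - meval (Phi s x ord0) p| <= D * `|t - s|.
Proof.
have [b b0 Kb] := compact_rV_box K_compact.
have [D D0 HD] := meval_box_bounded (lie_deriv f p) b.
exists D => // x t s Kx; have [_ dx] := Phi_flow Kx.
wlog st : s t / s <= t.
  move=> h; have [st|/ltW ts] := leP s t; first exact: h.
  by rewrite distrC [`|t - s|]distrC; exact: h.
have dp u := is_derive_meval p (dx u).
have [|c cts ->] := @MVT_segment R (fun u => meval (Phi u x ord0) p) _ s t st
    (fun u _ => dp u).
  by apply: derivable_within_continuous => u _; have := dp u => ?;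
    exact: ex_derive.
by rewrite normrM ler_wpM2r// HD// => i; apply: Kb; exact: flow_K.
Qed.

Lemma comb_orbit_lipschitz (m : nat) : exists2 D : R, 0 <= D &
  forall (k : 'I_m) a x t s, K x ->
    `|comb a (iter k (lie f) f) (Phi t x) -
      comb a (iter k (lie f) f) (Phi s x)| <= D * norm1 a * `|t - s|.
Proof.
have /choice[D HD] : forall ki : 'I_m * 'I_n, exists D : R, 0 <= D /\
    forall x t s, K x ->
    `|meval (Phi t x ord0) (iter ki.1 (lie f) f ki.2) -
      meval (Phi s x ord0) (iter ki.1 (lie f) f ki.2)| <= D * `|t - s|.
  move=> ki; have [D D0 HD] := meval_orbit_lipschitz (iter ki.1 (lie f) f ki.2).
  by exists D.
exists (\sum_ki D ki); first by apply: sumr_ge0 => i _; have [] := HD i.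
move=> k a x t s Kx; rewrite /comb -sumrB (le_trans (ler_norm_sum _ _ _))//.
rewrite /norm1 mulr_sumr mulr_suml; apply: ler_sum => i _.
rewrite -mulrBr normrM [X in X * `|t - s|]mulrC -mulrA ler_wpM2l//.
have [_ /(_ x t s Kx)/le_trans] := HD (k, i); apply; rewrite ler_wpM2r//.
rewrite (bigD1 (k, i))//= lerDl; apply: sumr_ge0 => j _; by have [] := HD j.
Qed.

(* Cramer's rule: [a * det M = (a M) adj M], and the entries of [adj M] are
   bounded on [K]. *)
Lemma krylov_nondegenerate : exists2 C : R, 0 < C &
  forall x a (q : R), K x -> 0 < q -> 0 < norm1 a ->
    q <= `|meval (x ord0) (krylov_det f)| ->
    exists k : 'I_n, q * norm1 a <= C * `|comb a (iter k (lie f) f) x|.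
Proof.
have [b b0 Kb] := compact_rV_box K_compact.
have /choice[B HB] : forall ki : 'I_n * 'I_n, exists B : R, 0 <= B /\
    forall x, K x -> `|meval (x ord0) (\adj (krylov_mx f) ki.1 ki.2)| <= B.
  move=> ki; have [B B0 HB] := meval_box_bounded (\adj (krylov_mx f) ki.1 ki.2)
    b.
  by exists B; split=> // x Kx; apply: HB; exact: Kb.
pose C := \sum_i \sum_k B (k, i).
have C0 : 0 <= C.
  by apply: sumr_ge0 => i _; apply: sumr_ge0 => k _; have [] := HB (k, i).
exists (C + 1); first by rewrite ltr_wpDl.
move=> x a q Kx q0 a0 qQ; apply: contrapT => /forallNP nk.
pose m := q * norm1 a / (C + 1).
have C10 : 0 < C + 1 by rewrite ltr_wpDl.
have m0 : 0 < m by rewrite divr_gt0// mulr_gt0.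
have wm (k : 'I_n) : `|comb a (iter k (lie f) f) x| <= m.
  rewrite ler_pdivlMr// mulrC ltW// ltNge; exact/negP/nk.
have E i : a ord0 i * meval (x ord0) (krylov_det f) =
    \sum_(k < n) comb a (iter k (lie f) f) x *
      meval (x ord0) (\adj (krylov_mx f) k i).
  have M := mul_mx_adj (krylov_mx f).
  transitivity (\sum_j a ord0 j * meval (x ord0) ((krylov_mx f *m \adj
    (krylov_mx f)) j i)).
    rewrite M (bigD1 i)//= big1 ?addr0 => [|j ji]; first by rewrite mxE eqxx.
    by rewrite mxE (negbTE ji) meval0 mulr0.
  under eq_bigr => j _ do rewrite mxE (raddf_sum (meval (x ord0))) mulr_sumr.
  rewrite exchange_big/=; apply: eq_bigr => k _; rewrite /comb mulr_suml.
  by apply: eq_bigr => j _; rewrite mevalM mxE mulrA.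
have : norm1 a * `|meval (x ord0) (krylov_det f)| <= m * C.
  rewrite /norm1 mulr_suml /C mulr_sumr; apply: ler_sum => i _.
  rewrite -normrM E (le_trans (ler_norm_sum _ _ _))// mulr_sumr.
  apply: ler_sum => k _; rewrite normrM ler_pM//.
  by have [_ ->] := HB (k, i).
apply/negP; rewrite -ltNge.
apply: lt_le_trans (_ : m * (C + 1) <= _); first by rewrite ltr_pM2l// ltrDl.
by rewrite /m divfK ?gt_eqF// mulrC ler_wpM2l// norm1_ge0.
Qed.

(** * Time blocks and stroboscopic sampling *)

Definition step (k : nat) : R := k.+1%:R^-1.

Lemma step_gt0 k : 0 < step k.
Proof. by rewrite invr_gt0. Qed.

Lemma continuous_affine_orbit a b x : K x -> continuous (fun s =>
  affine a b (Phi s x)).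
Proof.
move=> Kx t; apply/differentiable_continuous/derivable1_diffP.
by have := is_derive_affine a b t Kx => ?; exact: ex_derive.
Qed.

(** The order of the quantifiers is the content: [th] precedes [k], so the threshold on Q can shrink
    with the block, and [e] precedes the orbit, the block and the pair [(a, b)]. *)
Lemma block_sublevel : exists th : nat, forall (k : nat) (r eta : R),
  0 < r -> 0 < eta -> exists2 e : R, 0 < e & forall x (s : R) a (b : R), K x ->
    r <= norm1 a ->
    th%:R * step k <= `|meval (Phi s x ord0) (krylov_det f)| ->
    (lebesgue_measure [set t | s < t < (s + step k) /\
       `|affine a b (Phi t x)| < e]%R <= eta%:E)%E.
Proof.
have [C C0 HC] := krylov_nondegenerate.
have [D D0 HD] := comb_orbit_lipschitz n.
(* When |Q| is at least [th * tau] at the start of a block, some derivative there is at least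
   [(D + 1) * norm1 a * tau]. During the block it changes by at most [D * norm1 a * tau], which
   leaves [norm1 a * tau]. *)
pose th := (Num.truncn (C * (D + 1))).+1.
have thC : C * (D + 1) <= th%:R by rewrite ltW// truncnS_gt.
exists th => k r eta r0 eta0.
have th0 : 0 < th%:R :> R by rewrite ltr0n.
have tau0 := step_gt0 k; set tau := step k in tau0 *.
have rt0 : 0 < r * tau by rewrite mulr_gt0.
have /choice[e He] : forall j : 'I_n, exists e : R, 0 < e /\
    forall (h : nat -> R -> R) (a b : R),
    (forall i (t : R), (i < j.+1)%N -> is_derive t 1 (h i) (h i.+1 t)) ->
    (forall t, a < t < b -> r * tau <= `|h j.+1 t|) ->
    (lebesgue_measure [set t | (a < t < b) /\ `|h 0%N t| < e]%R <= eta%:E)%E.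
  by move=> j; have [e e0 He] := sublevel_measure_le j.+1 rt0 eta0; exists e.
(* The order of the large derivative depends on the point and on [a], hence the minimum over all
   orders; the default 1 serves [n = 0]. *)
exists (\big[Num.min/1]_(j < n) e j).
  by apply: lt_bigmin => // j _; have [] := He j.
move=> x s a b Kx ra Qs.
have a0 : 0 < norm1 a by exact: lt_le_trans ra.
have [j wj] := HC _ a _ (flow_K s Kx) (mulr_gt0 th0 tau0) a0 Qs.
pose h i : R -> R := if i is i'.+1 then fun t =>
  comb a (iter i' (lie f) f) (Phi t x)
  else fun t => affine a b (Phi t x).
have dh i (t : R) : (i < j.+1)%N -> is_derive t 1 (h i) (h i.+1 t).
  by case: i => [|i] _; [exact: is_derive_affine|exact: is_derive_comb].
have hm t : s < t < s + tau -> r * tau <= `|h j.+1 t|.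
  move=> /andP[st ts]; have := HD j a x t s Kx; rewrite -/(h j.+1 t).
  set w := comb _ _ (Phi s x) in wj *; set v := h _ _ => wv.
  have {}wv : `|w - v| <= D * norm1 a * tau.
    rewrite distrC (le_trans wv)// ler_wpM2l ?mulr_ge0 ?norm1_ge0//.
    by rewrite ger0_norm ?subr_ge0 1?ltW// ltrBlDl.
  have h1 : (D + 1) * norm1 a * tau <= `|w|.
    rewrite -(ler_pM2l C0) (le_trans _ wj)// !mulrA.
    rewrite [leRHS]mulrAC ler_pM2r// ler_pM2r//.
  have h2 : `|w| <= `|w - v| + `|v|.
    by rewrite -{1}(subrK v w) ler_normD.
  have h3 : r * tau <= norm1 a * tau by rewrite ler_pM2r.
  lra.
have [_ He'] := He j; apply: le_trans (He' h s (s + tau) dh hm).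
have ca := @continuous_affine_orbit a b _ Kx.
apply: le_measure; rewrite ?inE;
  [exact: measurable_sublevel|exact: measurable_sublevel|].
move=> t [stt ht]; split=> //; rewrite (lt_le_trans ht)//.
exact: bigmin_le_cond.
Qed.

Definition small (k th : nat) : set 'rV[R]_n :=
  [set y | `|meval (y ord0) (krylov_det f)| < th%:R * step k].

Definition stroboscope (k j : nat) : 'rV[R]_n ->
  'rV[R]_n := Phi (j%:R * step k).

(* The threshold [th * step k] is proportional to the time step, and [th] is
   universally quantified: a time shift by less than [step k] changes Q along
   the orbit by [O(step k)], hence only changes [th], which makes this set
   invariant. *)
Definition regular : set 'rV[R]_n := K `&` [set x | forall l th : nat,
  exists k N0 : nat, forall N : nat, (N0 <= N)%N ->
    visits (R := R) (stroboscope k) (small k th) x N <= l.+1%:R^-1 * N%:R].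

Definition sublevel (z : R -> 'rV[R]_n) (a : 'rV[R]_n) (b e : R) : set R :=
  [set t | `|affine a b (z t)| < e].

Lemma measurable_affine_sublevel a b e x : K x ->
  measurable (sublevel (Phi^~ x) a b e).
Proof.
move=> Kx; have : measurable_fun setT (fun t => `|affine a b (Phi t x)|).
  by apply: measurableT_comp => //; apply: continuous_measurable_fun;
    exact: continuous_affine_orbit.
move=> /(_ measurableT `]-oo, e[%classic (measurable_itv _)); rewrite setTI.
by congr measurable; apply/seteqP; split=> t; rewrite /= in_itv.
Qed.

(** A block whose starting point lies in [small k th] is charged its full length [step k], any other
    block only [eta]. *)
Lemma sublevel_blocks k th (e eta : R) x a b : K x -> 0 < eta ->
  (forall s, th%:R * step k <= `|meval (Phi s x ord0) (krylov_det f)| ->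
    (lebesgue_measure [set t | s < t < (s + step k) /\
       `|affine a b (Phi t x)| < e]%R <= eta%:E)%E) ->
  forall N, (lebesgue_measure (sublevel (Phi^~ x) a b e `&` `[0%R,
    (N%:R * step k)%R]) <=
    (step k * visits (R := R) (stroboscope k) (small k th) x N + N%:R *
      eta)%R%:E)%E.
Proof.
move=> Kx eta0 He; have mS := measurable_affine_sublevel a b e Kx.
have tau0 := step_gt0 k; set tau := step k in tau0 He *.
have ca := @continuous_affine_orbit a b _ Kx.
elim=> [|N IH].
  rewrite mul0r /visits big_geq// mulr0 mul0r addr0.
  rewrite -[leRHS](lebesgue_measure_set1 (0 : R)); apply: le_measure;
    rewrite ?inE//.
    by apply: measurableI.
  by move=> t [_] /=; rewrite in_itv/= -eq_le => /eqP.
set s := N%:R * tau.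
pose I := [set t | s < t < (s + tau) /\ `|affine a b (Phi t x)| < e].
have mI : measurable I := measurable_sublevel _ _ _ ca.
have m1 : measurable [set s + tau] by exact: measurable_set1.
set J := _ `&` `[0, s] in IH; have mJ : measurable J by exact: measurableI.
have mJI : measurable (J `|` I) by exact: measurableU.
(* The blocks are open intervals, so the endpoint [s + tau] is added as a null set. *)
have sub : sublevel (Phi^~ x) a b e `&` `[0, N.+1%:R * tau] `<=`
    (J `|` I) `|` [set s + tau].
  move=> t [St] /=; rewrite in_itv/= -natr1 mulrDl mul1r -/s => /andP[t0].
  rewrite le_eqVlt => /orP[/eqP ->|ts]; first by right.
  left; have [ts'|st] := leP t s; first by left; split=> //=;
    rewrite in_itv/= t0.
  by right; split=> //; rewrite st.
have mJIs : measurable ((J `|` I) `|` [set s + tau]) by exact: measurableU.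
apply: (@le_trans _ _ (lebesgue_measure ((J `|` I) `|` [set s + tau]))).
  by apply: le_measure; rewrite ?inE//; exact: measurableI.
have U1 := @measureU2 _ _ _ (@lebesgue_measure R) _ _ mJI m1.
have U2 := @measureU2 _ _ _ (@lebesgue_measure R) _ _ mJ mI.
apply: le_trans U1 _; rewrite [X in (_ + X)%E](lebesgue_measure_set1 (s + tau))
  adde0.
apply: le_trans U2 _.
have HI : (lebesgue_measure I <=
    (tau * \1_(small k th) (stroboscope k N x) + eta)%:E)%E.
  have [hs|hb] := leP (th%:R * tau) `|meval (Phi s x ord0) (krylov_det f)|.
    apply: le_trans (He s hs) _; rewrite lee_fin lerDr mulr_ge0 ?(ltW tau0)//.
  have -> : \1_(small k th) (stroboscope k N x) = 1 :> R by rewrite indicE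
    mem_set.
  rewrite mulr1; apply: (@le_trans _ _ (lebesgue_measure `]s,
    (s + tau)[%classic)).
    apply: le_measure; rewrite ?inE//.
    by move=> t [h _]; rewrite /= in_itv.
  rewrite lebesgue_measure_itv/= lte_fin ltrDl tau0 -EFinB lee_fin.
  by rewrite addrAC subrr add0r lerDl ltW.
apply: le_trans (leeD IH HI) _;
  rewrite -EFinD lee_fin /visits big_nat_recr//= -natr1.
by rewrite mulrDr mulrDl mul1r addrACA.
Qed.

(** Both conclusions of the theorem come from this estimate, in which [e] and [T0] serve every
    hyperplane with [r <= norm1 a]. Bad blocks and the remains of good blocks each contribute at
    most [lam / 4] of the time [N * step k], and rounding [T] up to whole blocks at most doubles it,
    so half of [lam * T] would suffice without rounding. *)
Lemma regular_sublevel x (r lam : R) : regular x -> 0 < r -> 0 < lam ->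
  exists2 e : R, 0 < e & exists2 T0 : R, 0 < T0 & forall a b, r <= norm1 a ->
    forall T, T0 <= T ->
    (lebesgue_measure (sublevel (Phi^~ x) a b e `&` `[0%R, T]) <=
      (lam * T)%:E)%E.
Proof.
move=> [Kx Rx] r0 lam0.
have [th Hth] := block_sublevel.
pose l := Num.truncn (4 / lam).
have lE : l.+1%:R^-1 <= lam / 4.
  rewrite -[leRHS]invf_div lef_pV2 ?posrE ?divr_gt0// ltW// truncnS_gt//.
have [k [N0 HN0]] := Rx l th.
have tau0 := step_gt0 k.
have eta0 : 0 < step k * lam / 4 by rewrite divr_gt0// mulr_gt0.
have [e e0 He] := Hth k r _ r0 eta0.
exists e => //; exists (N0.+1%:R * step k); first by rewrite mulr_gt0.
move=> a b ra T T0.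
pose N := (Num.truncn (T / step k)).+1.
have TN : T < N%:R * step k by rewrite -ltr_pdivrMr// truncnS_gt.
have NT : N%:R * step k <= T + step k.
  rewrite -natr1 mulrDl mul1r lerD2r -ler_pdivlMr//.
  by rewrite truncn_le divr_ge0// ?ltW// (lt_le_trans _ T0)// mulr_gt0.
have N0N : (N0 <= N)%N.
  rewrite -(ler_nat R) -(ler_pM2r tau0) ltW// (le_lt_trans _ TN)// (le_trans _
    T0)//.
  by rewrite ler_pM2r// ler_nat.
have mS := measurable_affine_sublevel a b e Kx.
apply: (@le_trans _ _ (lebesgue_measure (sublevel (Phi^~ x) a b e `&` `[0,
  N%:R * step k]))).
  apply: le_measure; rewrite ?inE; [exact: measurableI|exact: measurableI|].
  move=> t [St] /=; rewrite !in_itv/= => /andP[-> tT]; split=> //.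
  by rewrite (le_trans tT)// ltW.
have := sublevel_blocks Kx eta0 (fun s hs => He x s a b Kx ra hs) N.
move=> /le_trans; apply; rewrite lee_fin.
have v1 : visits (stroboscope k) (small k th) x N <= lam / 4 * N%:R.
  by apply: le_trans (HN0 N N0N) _; rewrite ler_wpM2r.
have v2 := ler_wpM2l (ltW tau0) v1.
have T1 : step k <= T by rewrite (le_trans _ T0)// ler_peMl ?(ltW tau0)// ler1n.
have l1 := ler_wpM2l (ltW lam0) NT; have l2 := ler_wpM2l (ltW lam0) T1.
nra.
Qed.

(** * Invariance of the regular set *)

Lemma stroboscope_in k j x : K x -> K (stroboscope k j x).
Proof. exact: flow_K. Qed.

Lemma stroboscope_id k x : K x -> stroboscope k 0 x = x.
Proof. by move=> Kx; rewrite /stroboscope mul0r; have [] := Phi_flow Kx. Qed.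

Lemma stroboscope_add k i j x : K x ->
  stroboscope k (i + j) x = stroboscope k i (stroboscope k j x).
Proof.
by move=> Kx; rewrite /stroboscope natrD mulrDl (flowD K_compact Phi_flow
  K_invariant).
Qed.

Lemma small_flow (th : nat) : exists th' : nat, forall k x s t, K x ->
  0 <= t - s <= step k -> small k th (Phi t x) -> small k th' (Phi s x).
Proof.
have [D D0 HD] := meval_orbit_lipschitz (krylov_det f).
exists (th + (Num.truncn D).+1)%N => k x s t Kx /andP[st ts];
  rewrite /small /= => Qt.
have tau0 := step_gt0 k.
have Dt : D <= (Num.truncn D).+1%:R by rewrite ltW// truncnS_gt.
have := HD x s t Kx; rewrite [`|s - t|]distrC (ger0_norm st) => h.
set q := meval (Phi s x ord0) _ in h *; set p := meval (Phi t x ord0) _ in h Qt.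
have h1 : `|q| <= `|q - p| + `|p| by rewrite -{1}(subrK p q) ler_normD.
have h2 := ler_wpM2l D0 ts; have h3 := ler_wpM2r (ltW tau0) Dt.
rewrite natrD mulrDl; lra.
Qed.

(** A time shift [t] is a whole number of steps plus a fraction of one. The fraction is absorbed by
    enlarging [th] to a [th'] independent of [x], [t] and [k]; the whole steps shift the count by
    [m], which does not depend on [N]. *)
Lemma visits_flow_le (th : nat) : exists th' : nat, forall x t k, K x ->
  exists m : nat, forall N,
  visits (R := R) (stroboscope k) (small k th) (Phi t x) N <=
  m%:R + visits (stroboscope k) (small k th') x (m + N).
Proof.
have [th' Hth'] := small_flow th; exists th' => x t k Kx.
have tau0 := step_gt0 k; have Kt := flow_K t Kx.
have flD := flowD K_compact Phi_flow K_invariant.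
(* The samples of [y] lie on the orbit of [x] with offset [s]; sample [j] of [y] is compared with
   sample [m + j] of [x], which is earlier by at most one step. *)
have shift m y s N : K y -> (forall j : nat,
  stroboscope k j y = Phi (j%:R * step k + s) x) ->
    m%:R * step k <= s <= m%:R * step k + step k ->
    visits (R := R) (stroboscope k) (small k th) y N <=
    visits (stroboscope k) (small k th') x (m + N).
  move=> Ky yE /andP[ms sm].
  rewrite (visitsD (stroboscope_add k))// -[leLHS]add0r lerD ?visits_ge0//.
  apply: ler_sum => j _; rewrite !indicE;
    have [ys|//] := boolP (stroboscope k j y \in _).
  rewrite mem_set//= -stroboscope_add//;
    apply: (Hth' k x _ (j%:R * step k + s)) => //.
    by rewrite natrD mulrDl; lra.
  by rewrite -yE; exact: set_mem.
have [t0|t0] := leP 0 t.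
  exists (Num.truncn (t / step k)) => N.
  apply: le_trans (shift (Num.truncn (t / step k)) _ t N Kt _ _) _.
  - by move=> j; rewrite /stroboscope flD.
  - have := truncnS_gt (t / step k).
    rewrite ltr_pdivrMr// -natr1 mulrDl mul1r => /ltW ->; rewrite andbT.
    by rewrite -ler_pdivlMr// truncn_le divr_ge0// ltW.
  - by rewrite lerDr.
(* For negative [t], [m] steps forward from [Phi t x] bring the offset back into [[0, step k]]; the
   [m] samples skipped account for the term [m]. *)
pose m := (Num.truncn (- t / step k)).+1; exists m => N.
have mt : 0 <= m%:R * step k + t <= step k.
  have h1 : - t < m%:R * step k by rewrite -ltr_pdivrMr// truncnS_gt.
  have h2 : m%:R * step k <= - t + step k.
    rewrite -natr1 mulrDl mul1r lerD2r -ler_pdivlMr//.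
    by rewrite truncn_le divr_ge0 ?oppr_ge0 ?ltW.
  by apply/andP; split; lra.
apply: (@le_trans _ _ (visits (stroboscope k) (small k th) (Phi t x) (m + N))).
  by apply: visits_le; rewrite leq_addl.
rewrite (visitsD (stroboscope_add k))// lerD ?visits_le_length//.
apply: le_trans (shift 0%N _ (m%:R * step k + t) N _ _ _) _.
- exact: stroboscope_in.
- by move=> j; rewrite /stroboscope -!flD ?addrA.
- by rewrite mul0r add0r.
- by apply: visits_le; rewrite add0n leq_addl.
Qed.

Lemma regular_flow t x : regular x -> regular (Phi t x).
Proof.
move=> [Kx Rx]; split; first exact: flow_K.
move=> l th; have [th' Hth'] := visits_flow_le th.
have [k [N0 HN0]] := Rx l.+1 th'.
have [m Hm] := Hth' x t k Kx.
(* The shift costs a bounded number of visits, paid for by the gap between two consecutive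
   frequencies. With [q = l + 1], the inequality [m + (m + N) / (q + 1) <= N / q] amounts to
   [m * q * (q + 2) <= N]. *)
exists k, (N0 + m * ((l.+3) * l.+1))%N => N NN.
apply: le_trans (Hm N) _.
have N0N : (N0 <= m + N)%N.
  by rewrite (leq_trans _ (leq_addl _ _))// (leq_trans _ NN)// leq_addr.
apply: le_trans (lerD (lexx _) (HN0 _ N0N)) _.
have : (m * (l.+3 * l.+1) <= N)%N by rewrite (leq_trans _ NN)// leq_addl.
rewrite -(ler_nat R) !natrM natrD -[l.+3%:R]natr1 -[l.+2%:R]natr1.
have : 0 < l.+1%:R :> R by [].
set q := l.+1%:R => q0 h.
have q1 : 0 < q + 1 by lra.
rewrite -(ler_pM2r (mulr_gt0 q0 q1)).
have -> : (m%:R + (q + 1)^-1 * (m%:R + N%:R)) * (q * (q + 1)) =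
   m%:R * (q * (q + 1)) + q * (m%:R + N%:R) by field; rewrite gt_eqF.
have -> : q^-1 * N%:R * (q * (q + 1)) = N%:R * (q + 1) by field; rewrite gt_eqF.
nra.
Qed.

Lemma measurable_small k th : measurable (small k th).
Proof.
have : measurable_fun setT (fun y : 'rV[R]_n =>
  `|meval (y ord0) (krylov_det f)|).
  by apply: measurableT_comp => //; exact: measurable_meval.
move=> /(_ measurableT `]-oo, (th%:R * step k)[%classic (measurable_itv _)).
by rewrite setTI.
Qed.

Let mK : measurable K := measurable_compact_rV K_compact.

Let mstrob k j (A : set 'rV[R]_n) : measurable A ->
  measurable (K `&` stroboscope k j @^-1` A).
Proof. exact: (measurable_flow K_compact Phi_flow K_invariant). Qed.

Lemma measurable_regular : measurable regular.
Proof.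
pose A l th k N := K `&` (visits (R := R) (stroboscope k) (small k th))^~ N
  @^-1` `]-oo, l.+1%:R^-1 * N%:R].
have -> : regular = \bigcap_l \bigcap_th \bigcup_k \bigcup_N0
    \bigcap_(N in [set N | (N0 <= N)%N]) A l th k N.
  apply/seteqP; split=> x.
    move=> [Kx Rx] l _ th _; have [k [N0 H]] := Rx l th.
    exists k => //; exists N0 => // N /= NN; split=> //=; rewrite in_itv/=;
      exact: H.
  move=> H; have Kx : K x.
    by have [k _ [N0 _ /(_ N0 (leqnn _))[]]] := H 0%N I 0%N I.
  split=> // l th; have [k _ [N0 _ HN]] := H l I th I.
  exists k, N0 => N NN; have [_] := HN N NN.
  by rewrite /= in_itv.
apply: bigcapT_measurable => l; apply: bigcapT_measurable => th.
apply: bigcupT_measurable => k; apply: bigcupT_measurable => N0.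
apply: bigcap_measurable; first by exists N0 => /=.
move=> N _; have := measurable_visits (R := R) (mstrob k) N (measurable_small k
  th) mK.
by move=> /(_ mK _ (measurable_itv `]-oo, l.+1%:R^-1 * N%:R])).
Qed.

(** * Almost every point is regular *)

Section almost_sure.
Variable mu : probability 'rV[R]_n R.
Hypothesis mu_K : mu K = 1%E.
Hypothesis mu_invariant : invariant_measure_on K Phi mu.
Hypothesis mu_density : bounded_density_on K mu.
Hypothesis Q_neq0 : exists2 xstar,
  K xstar & meval (xstar ord0) (krylov_det f) != 0.

Lemma krylov_det_null : mu [set x | meval (x ord0) (krylov_det f) = 0] = 0%E.
Proof.
have [x0 _ Qx0] := Q_neq0; have N0 := meval_zeros_null Qx0.
have [rho [c [C [mrho c0 rhoK ->]]]] := mu_density; last first.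
  have := measurable_meval (krylov_det f) measurableT (measurable_set1 0).
  by rewrite setTI.
set Z := [set x | _] in N0 *.
have mZ : measurable Z.
  have := measurable_meval (krylov_det f) measurableT (measurable_set1 0).
  by rewrite setTI.
have mZK : measurable (Z `&` K) by exact: measurableI.
rewrite (@ge0_negligible_integral _ _ _ _ _ (Z `&` K))//.
- by rewrite setDv integral_set0.
- apply/measurable_EFinP; apply: measurable_funS mrho => //.
- move=> x [_ Kx]; rewrite lee_fin; have /andP[h _] := rhoK x Kx.
  by rewrite (le_trans _ h)// ltW.
- apply: (subset_measure0 _ _ _ N0) => //.
Qed.

Lemma small_cvg0 th : mu (small k th) @[k --> \oo] --> 0%E.
Proof.
have mcap : measurable (\bigcap_k small k th).
  by apply: bigcapT_measurable => k; exact: measurable_small.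
have -> : 0%E = mu (\bigcap_k small k th).
  apply/esym; apply: (subset_measure0 _ _ _ krylov_det_null) => //.
    have := measurable_meval (krylov_det f) measurableT (measurable_set1 0).
    by rewrite setTI.
  move=> x Hx /=; apply/eqP; rewrite -normr_eq0; apply: contrapT => /negP Q0.
  have {}Q0 : 0 < `|meval (x ord0) (krylov_det f)| by rewrite lt_neqAle eq_sym
    Q0/=.
  set q := `|_| in Q0; pose k := Num.truncn (th%:R / q).
  have := Hx k I; rewrite /small /= -/q ltNge => /negP; apply.
  by rewrite /step ler_pdivrMr// mulrC -ler_pdivrMr// ltW// truncnS_gt.
apply: (@nonincreasing_cvg_mu _ _ _ mu (fun k => small k th)).
- by rewrite (le_lt_trans (probability_le1 _ _)) ?ltry//;
  exact: measurable_small.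
- by move=> k; exact: measurable_small.
- exact: mcap.
- move=> i j ij; apply/subsetPset => x; rewrite /small /= => /lt_le_trans;
  apply.
  by rewrite ler_wpM2l// /step lef_pV2 ?posrE// ler_nat.
Qed.

(** For given [l] and [th], a point of [K] violates regularity only if it lies in [U l th k] for
    every [k]. The maximal inequality bounds the measure of that intersection by
    [(l + 1) * mu (small k th)] for each [k], and these bounds tend to 0. *)
Lemma regular_full : mu regular = 1%E.
Proof.
pose U l th k := K `&` [set x | exists N, l.+1%:R^-1 * N%:R <
  visits (R := R) (stroboscope k) (small k th) x N].
have mU l th k : measurable (U l th k).
  rewrite (_ : U l th k = \bigcup_N (K `&` (visits (R := R) (stroboscope k)
    (small k th))^~ N
     @^-1` `]l.+1%:R^-1 * N%:R, +oo[%classic)).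
    apply: bigcupT_measurable => N.
    have := measurable_visits (R := R) (mstrob k) N (measurable_small k th) mK.
    by move=> /(_ mK _ (measurable_itv `]l.+1%:R^-1 * N%:R, +oo[)).
  apply/seteqP; split=> x.
    by move=> [Kx [N HN]]; exists N => //; split=> //=; rewrite in_itv/= HN.
  by move=> [N _ [Kx]]; rewrite /= in_itv/= andbT => HN; split=> //; exists N.
have nU l th : mu.-negligible (\bigcap_k U l th k).
  exists (\bigcap_k U l th k); split=> //; first exact: bigcapT_measurable.
  apply/eqP; rewrite eq_le measure_ge0 andbT.
  have l0 : 0 <= (l.+1%:R^-1 : R) <=
    1 by rewrite invr_ge0 ler0n invf_le1//= ler1n.
  have le k : (mu (\bigcap_k U l th k) <= l.+1%:R%:E * mu (small k th))%E.
    apply: (@le_trans _ _ (mu (U l th k))).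
      apply: le_measure; rewrite ?inE//; first exact: bigcapT_measurable.
      by move=> x; apply.
    have := visits_maximal_inequality (mu := mu) (@stroboscope_in k)
      (@stroboscope_id k) (@stroboscope_add k) (mstrob k)
      (fun i A mA => mu_invariant (i%:R * step k) mA) mK (measurable_small k
        th) l0.
    have l1 : (0 <= (l.+1%:R : R)%:E)%E by rewrite lee_fin.
    by move=> /(lee_wpmul2l l1); rewrite muleA -EFinM mulfV ?pnatr_eq0// mul1e.
  have cv : (l.+1%:R%:E * mu (small k th))%E @[k --> \oo] -->
    (l.+1%:R%:E * 0)%E.
    by apply: cvgeZl => //; exact: small_cvg0.
  rewrite mule0 in cv; rewrite -(cvg_lim _ cv)//; apply: lime_ge.
    by apply/cvg_ex; eexists; exact: cv.
  exact: nearW.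
have nB : mu.-negligible (\bigcup_l \bigcup_th \bigcap_k U l th k).
  by apply: negligible_bigcup => l; exact: negligible_bigcup.
have mR := measurable_regular.
have KR : mu (K `\` regular) = 0%E.
  apply: measure_negligible; first exact: measurableD.
  apply: negligibleS nB => x [Kx nR]; apply: contrapT => nx; apply: nR; split=>
    // l th.
  apply: contrapT => h; apply: nx; exists l => //; exists th => // k _.
  (* Outside [U l th k] the frequency bound holds for every length, so [N0 = 0] will do. *)
  split=> //; apply: contrapT => nN; apply: h; exists k, 0%N => N _.
  by rewrite leNgt; apply/negP => hN; apply: nN; exists N.
have E : (mu K = mu (K `\` regular) + mu (K `&` regular))%E := measureDI mu mK
  mR.
have -> : regular = K `&` regular.
  by apply/seteqP; split=> x; [move=> Rx; split=> //; case: Rx|case].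
by move: E; rewrite mu_K KR add0e.
Qed.

End almost_sure.

End excitation.

(** * Time averages *)

Lemma continuous_sum_fun (R : realType) (T : topologicalType) (k : nat)
  (g : 'I_k -> T -> R) : (forall i, continuous (g i)) ->
  continuous (fun x => \sum_i g i x).
Proof.
elim: k g => [|k IH] g cg x.
  rewrite (_ : (fun _ => _) = cst 0); first exact: cst_continuous.
  by apply/funext => y; rewrite big_ord0.
rewrite (_ : (fun _ => _) = g ord0 \+ (fun x => \sum_i g (lift ord0 i) x)).
  by apply: continuousD; [exact: cg|exact: IH].
by apply/funext => y; rewrite big_ord_recl.
Qed.

Section time_averages.
Context {R : realType}.
Implicit Types (g : R -> R) (A : set R) (T : R).

Lemma limf_esup_pinfty_le (u : R -> \bar R) (M : \bar R) (T0 : R) :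
  (forall T, T0 <= T -> (u T <= M)%E) -> (limf_esup u +oo%R <= M)%E.
Proof.
move=> uM; rewrite limf_esupE; apply: ge_ereal_inf.
exists (ereal_sup (u @` [set T | T0 <= T])).
  by exists [set T | T0 <= T] => //; exact: nbhs_pinfty_ge (num_real T0).
by apply: ge_ereal_sup => _ [T T0T <-]; exact: uM.
Qed.

Lemma limf_einf_pinfty_ge (u : R -> \bar R) (M : \bar R) (T0 : R) :
  (forall T, T0 <= T -> (M <= u T)%E) -> (M <= limf_einf u +oo%R)%E.
Proof.
move=> uM; rewrite limf_einfE; apply: le_ereal_sup_tmp.
exists (ereal_inf (u @` [set T | T0 <= T])).
  by exists [set T | T0 <= T] => //; exact: nbhs_pinfty_ge (num_real T0).
by apply: le_ereal_inf_tmp => _ [T T0T <-]; exact: uM.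
Qed.

Lemma time_avg_ge0 g T : (forall t, 0 <= g t) -> 0 <= time_avg g T.
Proof.
move=> g0; rewrite /time_avg; have [T0|T0] := leP 0 T.
  by rewrite mulr_ge0 ?invr_ge0// Rintegral_ge0.
by rewrite set_itv_ge ?Rintegral_set0 ?mulr0// bnd_simp -ltNge.
Qed.

Lemma lebesgue_itv0 T : 0 <= T -> lebesgue_measure `[0,
  T]%classic = T%:E :> \bar R.
Proof.
move=> T0; rewrite lebesgue_measure_itv/= lte_fin; case: ifPn => [_|].
  by rewrite sube0.
by rewrite -leNgt => T0'; congr (_%:E); apply/eqP; rewrite eq_le T0.
Qed.

Lemma time_avg_indic A T : measurable A ->
  time_avg \1_A T = T^-1 * fine (lebesgue_measure (A `&` `[0, T])).
Proof.
by move=> mA; rewrite /time_avg /Rintegral; congr (_ * fine _);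
  rewrite integral_indic.
Qed.

Lemma continuous_integrable_itv g T : continuous g ->
  (@lebesgue_measure R).-integrable `[0, T] (EFin \o g).
Proof.
move=> cg; apply: continuous_compact_integrable; first exact: segment_compact.
exact: continuous_subspaceT.
Qed.

Lemma time_avgZ c g T : continuous g ->
  time_avg (fun t => c * g t) T = c * time_avg g T.
Proof.
move=> cg; rewrite /time_avg RintegralZl//;
  last exact: continuous_integrable_itv.
by rewrite mulrCA.
Qed.

Lemma time_avg_sum (k : nat) (g : 'I_k -> R -> R) T : (forall i,
  continuous (g i)) ->
  time_avg (fun t => \sum_i g i t) T = \sum_i time_avg (g i) T.
Proof.
move=> cg; rewrite /time_avg -mulr_sumr; congr (_ * _).
elim: k g cg => [|k IH] g cg.
  rewrite big_ord0 (_ : (fun _ => _) = cst 0) ?Rintegral_cst ?mul0r//.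
  by apply/funext => t; rewrite big_ord0.
rewrite big_ord_recl -(IH (fun i => g (lift ord0 i)))// -RintegralD//.
- by congr Rintegral; apply/funext => t; rewrite big_ord_recl.
- exact: continuous_integrable_itv.
- by apply: continuous_integrable_itv; exact: continuous_sum_fun.
Qed.

(** A Chebyshev bound: integrate [c * (1 - \1_A) <= g] over [[0, T]]. *)
Lemma time_avg_ge g A (c lam T : R) : continuous g -> measurable A -> 0 < T ->
  (forall t, 0 <= g t) -> 0 <= c -> (forall t, ~ A t -> c <= g t) ->
  (lebesgue_measure (A `&` `[0%R, T]) <= (lam * T)%:E)%E ->
  c * (1 - lam) <= time_avg g T.
Proof.
move=> cg mA T0 g0 c0 cA leA.
have fT : (lebesgue_measure `[0%R, T] < +oo :> \bar R)%E.
  by rewrite lebesgue_itv0 ?ltW// ltry.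
have iA : (@lebesgue_measure R).-integrable `[0, T] (EFin \o \1_A).
  apply: measurable_bounded_integrable => //.
  exists 1; split=> // M M1 t _ /=; rewrite indicE normr_nat.
  by rewrite (le_trans _ (ltW M1))// lern1 leq_b1.
have ic : (@lebesgue_measure R).-integrable `[0, T] (EFin \o (cst 1 : R -> R)).
  by apply: continuous_integrable_itv; exact: cst_continuous.
have iB : (@lebesgue_measure R).-integrable `[0, T] (EFin \o (fun t =>
  1 - \1_A t)).
  rewrite (_ : EFin \o _ = (EFin \o (cst 1%R : R -> R)) \- (EFin \o \1_A))%E.
    by apply: (@integrableB _ _ _ (@lebesgue_measure R)) ic iA.
  by apply/funext => t; rewrite /= EFinB.
have mAT : measurable (A `&` `[0, T]) by exact: measurableI.
have iAE : \int[lebesgue_measure]_(t in `[0, T]) \1_A t =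
    fine (lebesgue_measure (A `&` `[0, T])).
  by rewrite /Rintegral integral_indic.
have finA : lebesgue_measure (A `&` `[0, T]) \is a fin_num.
  by rewrite ge0_fin_numE// (le_lt_trans leA)// ltry.
have leA' : fine (lebesgue_measure (A `&` `[0, T])) <= lam * T.
  by rewrite -lee_fin fineK.
rewrite /time_avg [leRHS]mulrC ler_pdivlMr// -mulrA.
apply: (@le_trans _ _ (\int[lebesgue_measure]_(t in `[0,
  T]) (c * (1 - \1_A t)))).
  rewrite RintegralZl// ler_wpM2l// RintegralB// iAE Rintegral_cst//.
  rewrite [X in 1 * fine X](lebesgue_itv0 (ltW T0)) /= mul1r mulrBl mul1r.
  exact: lerB.
apply: le_Rintegral => //.
- rewrite (_ : EFin \o _ = (fun t => c%:E * (1 - \1_A t)%R%:E)%E).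
    by apply: (@integrableZl _ _ _ (@lebesgue_measure R)) iB.
  by apply/funext => t; rewrite /= EFinM.
- exact: continuous_integrable_itv.
- move=> t _; rewrite indicE; have [At|nAt] := boolP (t \in A).
    by rewrite subrr mulr0.
  by rewrite subr0 mulr1 cA// => /mem_set; rewrite (negbTE nAt).
Qed.

End time_averages.

(** * Euclidean norm and neighbourhoods of hyperplanes *)

Section enorm.
Context {R : realType} {n : nat}.
Implicit Types x y a : 'rV[R]_n.

Lemma coord_le_enorm x i : `|x ord0 i| <= enorm x.
Proof.
rewrite -sqrtr_sqr ler_wsqrtr// (bigD1 i)//= lerDl.
by apply: sumr_ge0 => j _; exact: sqr_ge0.
Qed.

Lemma enorm_sqr x : enorm x ^+ 2 = \sum_i x ord0 i ^+ 2.
Proof. by rewrite sqr_sqrtr// sumr_ge0// => i _; exact: sqr_ge0. Qed.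

Lemma enorm_sqr_le_norm1 x : enorm x ^+ 2 <= norm1 x ^+ 2.
Proof.
rewrite enorm_sqr expr2 [in leRHS]/norm1 mulr_suml; apply: ler_sum => i _.
rewrite -real_normK ?num_real// expr2 ler_wpM2l//.
by rewrite /norm1 (bigD1 i)//= lerDl; exact: sumr_ge0.
Qed.

Lemma continuous_enorm_sub y : continuous (fun x => enorm (x - y)).
Proof.
move=> x; apply: (@continuous_comp _ _ _ (fun x =>
  \sum_i (x - y) ord0 i ^+ 2) Num.sqrt).
  apply: continuous_sum_fun => i {}x.
  have h : {for x, continuous (fun x : 'rV[R]_n => x ord0 i - y ord0 i)}.
    by apply: continuousB; [exact: coord_continuous|exact: cst_continuous].
  rewrite (_ : (fun _ => _) = (fun x : 'rV[R]_n => x ord0 i - y ord0 i) \*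
     (fun x : 'rV[R]_n => x ord0 i - y ord0 i)); last first.
    by apply/funext => s; rewrite /= !mxE expr2.
  exact: continuousM.
exact: sqrt_continuous.
Qed.

(** Nonemptiness of [H] excludes the default value [inf set0 = 0], which would put every point at
    distance 0 from the empty set. *)
Lemma edist_ltE (H : set 'rV[R]_n) x (e : R) : H !=set0 ->
  Defs.edist x H < e <-> exists2 y, H y & enorm (x - y) < e.
Proof.
move=> [y0 Hy0]; split.
  move=> /inf_lt[|_ [y Hy <-] xy]; first by exists (enorm (x - y0)), y0.
  by exists y.
move=> [y Hy xy]; apply: le_lt_trans xy; apply: ge_inf; last by exists y.
by exists 0 => _ [z _ <-]; exact: sqrtr_ge0.
Qed.

Lemma norm1_gt0 a : a != 0 -> 0 < norm1 a.
Proof.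
move=> a0; rewrite lt_neqAle sumr_ge0// andbT; apply: contraNneq a0 => /esym a0.
apply/eqP/rowP => i; rewrite mxE; apply/eqP; rewrite -normr_le0 -a0.
by rewrite /norm1 (bigD1 i)//= lerDl; exact: sumr_ge0.
Qed.

Lemma affine_hyperplane_nonempty (H : set 'rV[R]_n) : affine_hyperplane H ->
  H !=set0.
Proof.
move=> [a [b [a0 ->]]].
have a20 : 0 < enorm a ^+ 2.
  have [i ai] : exists i, a ord0 i != 0.
    apply: contrapT => /forallNP h; move/eqP: a0; apply; apply/rowP => i;
      rewrite mxE.
    by have /negP := h i; rewrite negbK => /eqP.
  rewrite exprn_gt0// (lt_le_trans _ (coord_le_enorm a i))//.
  by rewrite normr_gt0.
exists ((b / enorm a ^+ 2) *: a) => /=.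
under eq_bigr => i _ do rewrite mxE mulrCA -expr2.
by rewrite -mulr_sumr -enorm_sqr divfK// gt_eqF.
Qed.

Lemma hyperplane_nbhd_affine (K : set 'rV[R]_n) a b (e : R) x : a != 0 ->
  hyperplane_nbhd K [set y | \sum_(i < n) a ord0 i * y ord0 i = b] e x ->
  `|affine a (- b) x| < norm1 a * e.
Proof.
move=> a0 [_ /edist_ltE]; move=>
  /(_ (affine_hyperplane_nonempty _)) [|y /= yb xy].
  by exists a, b.
rewrite /affine -yb -sumrB (le_lt_trans (ler_norm_sum _ _ _))//.
apply: (@le_lt_trans _ _ (norm1 a * enorm (x - y)));
  last by rewrite ltr_pM2l// norm1_gt0.
rewrite /norm1 mulr_suml; apply: ler_sum => i _.
rewrite -mulrBr normrM ler_wpM2l//.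
by have := coord_le_enorm (x - y) i; rewrite !mxE.
Qed.

End enorm.

(** * Hyperplanes and excitation *)

Section orbit_averages.
Context {R : realType} {n : nat}.
Variables (f : 'I_n -> mpoly n R) (Phi : R -> 'rV[R]_n -> 'rV[R]_n).
Variable K : set 'rV[R]_n.
Hypothesis K_compact : compact K.
Hypothesis Phi_flow : is_flow_on K f Phi.
Hypothesis K_invariant : flow_invariant Phi K.
Variable x : 'rV[R]_n.
Hypothesis x_regular : regular f Phi K x.

Let Kx : K x. Proof. by case: x_regular. Qed.

(** The hits form a union over the points of [H], in general uncountable, but each member is open in
    [t]. Membership in [K] holds at all times by invariance. *)
Lemma measurable_hyperplane_hits (H : set 'rV[R]_n) (e : R) : affine_hyperplane
  H ->
  measurable [set t | hyperplane_nbhd K H e (Phi t x)].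
Proof.
move=> hH.
have H0 := affine_hyperplane_nonempty hH.
rewrite (_ : mkset _ = \bigcup_(h in H) [set t | enorm (Phi t x - h) < e]);
  last first.
  apply/seteqP; split=> t.
    by move=> [_ /(edist_ltE _ _ H0)[h Hh he]]; exists h.
  move=> [h Hh he]; split; first exact: (flow_in K_invariant _ Kx).
  by apply/(edist_ltE _ _ H0); exists h.
suff o : forall h, H h -> open [set t : R | enorm (Phi t x - h) < e].
  exact: open_measurable (bigcup_open o).
move=> h _; apply: (@open_comp _ _ (fun t =>
  enorm (Phi t x - h)) [set u | u < e]).
  move=> t _; apply: (@continuous_comp _ _ _ (Phi^~ x) (fun y =>
    enorm (y - h))).
    exact: (continuous_orbit Phi_flow).
  exact: continuous_enorm_sub.
exact: open_lt.
Qed.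

Lemma hyperplane_avg_le (H : set 'rV[R]_n) (lam : R) : affine_hyperplane H ->
  0 < lam ->
  \forall e \near 0^'+, exists2 T0 : R, 0 < T0 & forall T, T0 <= T ->
    time_avg (fun t => \1_(hyperplane_nbhd K H e) (Phi t x)) T <= lam.
Proof.
move=> hH lam0; have [a [b [a0 HE]]] := hH.
have na := norm1_gt0 a0.
have [e e0 [T0 T00 HT]] := regular_sublevel K_compact Phi_flow K_invariant
  x_regular na lam0.
near=> d; exists T0 => // T TT0.
have T1 : 0 < T by exact: lt_le_trans TT0.
have mA := measurable_hyperplane_hits d hH.
rewrite (_ : (fun t => _) = \1_[set t | hyperplane_nbhd K H d (Phi t x)]);
  last first.
  by apply/funext => t; rewrite !indicE; congr (_%:R); congr nat_of_bool;
    apply/idP/idP => /set_mem h; apply/mem_set.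
rewrite time_avg_indic// mulrC ler_pdivrMr// -lee_fin.
set S := [set t | _]; have le : (lebesgue_measure (S `&` `[0%R, T]) <=
  (lam * T)%:E)%E.
  apply: le_trans (HT a (- b) (lexx _) T TT0).
  have mS := measurable_affine_sublevel Phi_flow a (- b) e Kx.
  apply: le_measure; rewrite ?inE; [exact: measurableI|exact: measurableI|].
  move=> t [St tT]; split=> //; rewrite /sublevel /=.
  move: St; rewrite /S /= HE => /(hyperplane_nbhd_affine a0)/lt_le_trans; apply.
  (* A neighbourhood of width at most [e / norm1 a] lies in the sublevel set of height [e]. *)
  rewrite mulrC -ler_pdivlMr// ltW//; near: d; apply: nbhs_right_lt.
  by rewrite divr_gt0.
by rewrite fineK// ge0_fin_numE// (le_lt_trans le)// ltry.
Unshelve. all: by end_near. Qed.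

Lemma hyperplane_limsup_cvg0 (H : set 'rV[R]_n) : affine_hyperplane H ->
  limf_esup (fun T : R =>
    (time_avg (fun t => \1_(hyperplane_nbhd K H eps) (Phi t x)) T)%:E)
    +oo%R @[eps --> 0^'+] --> 0%E.
Proof.
move=> hH.
pose L eps := limf_esup (fun T : R =>
    (time_avg (fun t => \1_(hyperplane_nbhd K H eps) (Phi t x)) T)%:E) +oo%R.
have L0 eps : (0 <= L eps)%E.
  apply: limf_esup_ge0; first exact: filter_not_empty.
  by move=> T; rewrite lee_fin time_avg_ge0// => t; rewrite indicE.
have Ll lam : 0 < lam -> \forall e \near 0^'+, (L e <= lam%:E)%E.
  move=> lam0; have := hyperplane_avg_le hH lam0; apply: filterS => e [T0 _ HT].
  by apply: (limf_esup_pinfty_le (T0 := T0)) => T TT0; rewrite lee_fin HT.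
apply/fine_cvgP; split.
  have := Ll 1 ltr01; apply: filterS => e le.
  by rewrite ge0_fin_numE ?L0// (le_lt_trans le)// ltry.
apply/cvgrPdist_le => lam lam0; have := Ll _ lam0; apply: filterS => e le.
rewrite sub0r normrN /= ger0_norm ?fine_ge0 ?L0// -lee_fin fineK//.
by rewrite ge0_fin_numE ?L0// (le_lt_trans le)// ltry.
Qed.

Lemma excitation_quadratic (z : R -> 'rV[R]_n) (a : 'rV[R]_n) (b T : R) :
  (forall i, continuous (fun t => z t ord0 i)) ->
  let u := row_mx a b%:M in
  (u *m excitation_mx z T *m u^T) ord0 ord0 =
    time_avg (fun t => affine a b (z t) ^+ 2) T.
Proof.
move=> cz u.
pose phi i t : R := augment (z t) ord0 i.
have cphi i : continuous (phi i).
  rewrite /phi /augment; case: (split_ordP i) => j ->.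
    by under eq_fun do rewrite row_mxEl; exact: cz.
  by under eq_fun do rewrite row_mxEr mxE; exact: cst_continuous.
have affE t : affine a b (z t) = \sum_i u ord0 i * phi i t.
  rewrite big_split_ord/= /affine big_ord1 /u row_mxEr /phi row_mxEr !mxE/=
    mulr1.
  by congr (_ + _); apply: eq_bigr => i _; rewrite !row_mxEl.
have cM (g h : R -> R) : continuous g -> continuous h ->
    continuous (fun t => g t * h t).
  by move=> cg ch t; exact: (continuousM (cg t) (ch t)).
have ccst (c : R) : continuous (fun _ : R => c) by exact: cst_continuous.
have cu i j : continuous (fun t => u ord0 i * (phi i t * phi j t)).
  by apply: (cM) => //; exact: cM.
rewrite (_ : (fun t => _) = fun t =>
    \sum_j (u ord0 j * \sum_i u ord0 i * (phi i t * phi j t))); last first.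
  apply/funext => t; rewrite affE expr2 mulr_sumr; apply: eq_bigr => j _.
  rewrite mulrC -mulrA; congr (_ * _); rewrite mulr_sumr; apply: eq_bigr => i _.
  by rewrite mulrCA [phi j t * _]mulrC.
rewrite time_avg_sum; last first.
  by move=> j; apply: (cM) => //; exact: continuous_sum_fun.
rewrite mxE; apply: eq_bigr => j _; rewrite time_avgZ;
  last exact: continuous_sum_fun.
rewrite time_avg_sum// [u^T _ _]mxE mulrC; congr (_ * _).
rewrite mxE; apply: eq_bigr => i _; rewrite time_avgZ; last exact: cM.
rewrite [excitation_mx _ _ _ _]mxE; congr (_ * time_avg _ _); apply/funext => t.
by rewrite mxE big_ord1 mxE.
Qed.

Lemma orbit_exciting : affinely_integrally_exciting (fun t => Phi t x).
Proof.
have [B B0 KB] := compact_rV_box K_compact.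
have KP t : K (Phi t x) by exact: (flow_in K_invariant _ Kx).
have czx := continuous_orbit Phi_flow Kx.
have cz i : continuous (fun t => Phi t x ord0 i).
  move=> t; apply: (@continuous_comp _ _ _ (Phi^~ x) (fun y => y ord0 i));
    first exact: czx.
  exact: coord_continuous.
split.
- apply: (@measurability _ _ _ _ _ _ (@open 'rV[R]_n)) => //.
  move=> _ [U oU <-]; apply: measurableI => //; apply: open_measurable.
  by apply: open_comp => // t _; exact: czx.
- exists (Num.sqrt (\sum_(i < n) B ^+ 2)) => t _; rewrite ler_wsqrtr//.
  apply: ler_sum => i _; rewrite -real_normK ?num_real// lerXn2r ?nnegrE//.
  exact: KB.
(* If [norm1 a < r], then [|a.z| <= 1/4] on [K] and the squared norm of [a] is at most 1/16. Hence
   [b ^+ 2 >= 15/16], so [|b| >= 3/4] and [|a.z + b| >= 1/2]. *)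
pose r : R := (4 * (B + 1))^-1.
have r0 : 0 < r by rewrite invr_gt0 mulr_gt0// ltr_wpDl.
have h0 : 0 < 2^-1 :> R by rewrite invr_gt0.
have [e e0 [T0 T00 HT]] := regular_sublevel K_compact Phi_flow K_invariant
  x_regular r0 h0.
(* The bound 1/4 serves small [a]. For the others, [|a.z + b| >= e] for at least half of the time,
   whence [e ^+ 2 / 2]. Halving [be] afterwards makes the inequality on the liminf strict. *)
pose be : R := Num.min (4^-1) (e ^+ 2 / 2).
have be0 : 0 < be by rewrite lt_min invr_gt0 ltr0n/= divr_gt0// exprn_gt0.
exists (be / 2); first by rewrite divr_gt0.
move=> a b ab; cbv zeta; apply: (@lt_le_trans _ _ be%:E).
  by rewrite lte_fin ltr_pdivrMr// ltr_pMr// ltr1n.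
apply: (limf_einf_pinfty_ge (T0 := T0)) => T TT0.
have T1 : 0 < T by exact: lt_le_trans TT0.
rewrite lee_fin excitation_quadratic//.
have ca := @continuous_affine_orbit _ _ _ _ _ Phi_flow a b _ Kx.
have ca2 : continuous (fun t => affine a b (Phi t x) ^+ 2).
  move=> t; under eq_fun do rewrite expr2.
  exact: (continuousM (ca t) (ca t)).
have [ra|ar] := leP r (norm1 a).
  have mS := measurable_affine_sublevel Phi_flow a b e Kx.
  have large t : ~ sublevel (Phi^~ x) a b e t -> e ^+ 2 <=
    affine a b (Phi t x) ^+ 2.
    rewrite /sublevel /= => /negP; rewrite -leNgt => h.
    rewrite -(real_normK (num_real (affine _ _ _))) lerXn2r// nnegrE//.
    exact: ltW.
  have := time_avg_ge ca2 mS T1 (fun t =>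
    sqr_ge0 _) (sqr_ge0 e) large (HT a b ra T TT0).
  apply: le_trans; rewrite ge_min; apply/orP; right.
  by rewrite le_eqVlt; apply/orP; left; apply/eqP; field.
have large t : ~ set0 t -> 4^-1 <= affine a b (Phi t x) ^+ 2.
  move=> _.
  have B1 : 0 < 4 * (B + 1) by rewrite mulr_gt0// ltr_wpDl.
  have aB : norm1 a * (4 * (B + 1)) < 1.
    by rewrite -ltr_pdivlMr// mul1r.
  have n0 := norm1_ge0 a.
  have h1 : `|\sum_i a ord0 i * Phi t x ord0 i| <= norm1 a * B.
    rewrite (le_trans (ler_norm_sum _ _ _))// /norm1 mulr_suml.
    by apply: ler_sum => i _; rewrite normrM ler_wpM2l// KB.
  set s := \sum_i _ in h1; have bs : affine a b (Phi t x) = s + b by [].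
  have a2 := enorm_sqr_le_norm1 a.
  have b2 : 15 / 16 <= b ^+ 2 by nra.
  have s4 : `|s| <= 4^-1 by nra.
  rewrite bs; move: s4; rewrite ler_norml => /andP[s1 s2].
  have [b0|b0] := leP 0 b.
    have b3 : 3 / 4 <= b by nra.
    nra.
  have b3 : b <= - (3 / 4) by nra.
  nra.
have null : (lebesgue_measure (set0 `&` `[0%R, T]) <= (0 * T)%:E :> \bar R)%E.
  by rewrite set0I measure0 mul0r.
have c0 : 0 <= 4^-1 :> R by rewrite invr_ge0.
have := time_avg_ge ca2 measurable0 T1 (fun t => sqr_ge0 _) c0 large null.
by apply: le_trans; rewrite subr0 mulr1 ge_min lexx.
Qed.

End orbit_averages.

Unset Implicit Arguments.

Theorem corollary5 (R : realType) (n : nat) (f : 'I_n -> mpoly n R)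
    (Phi : R -> 'rV[R]_n -> 'rV[R]_n) (K : set 'rV[R]_n)
    (mu : probability 'rV[R]_n R)
    (K_compact : compact K) (Phi_flow : is_flow_on K f Phi)
    (K_invariant : flow_invariant Phi K)
    (mu_K : mu K = 1%E) (mu_invariant : invariant_measure_on K Phi mu)
    (mu_density : bounded_density_on K mu)
    (Q_neq0 : exists2 xstar, K xstar & meval (xstar ord0) (krylov_det f) != 0) :
  exists X0 : set 'rV[R]_n,
    [/\ X0 `<=` K, measurable X0, flow_invariant Phi X0, mu X0 = 1%E &
      forall x, X0 x ->
        (forall H, affine_hyperplane H ->
          limf_esup (fun T : R =>
            (time_avg (fun t => \1_(hyperplane_nbhd K H eps) (Phi t x)) T)%:E)
            +oo%R @[eps --> 0^'+] --> 0%E) /\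
        affinely_integrally_exciting (fun t => Phi t x)].
Proof.
exists (regular f Phi K); split.
- by move=> x [].
- exact: (measurable_regular K_compact Phi_flow K_invariant).
- move=> t _ [x Rx <-]; exact: (regular_flow K_compact Phi_flow K_invariant).
- exact: (regular_full K_compact Phi_flow K_invariant mu_K mu_invariant
    mu_density Q_neq0).
- move=> x Rx; split.
    by move=> H; exact: (hyperplane_limsup_cvg0 K_compact Phi_flow K_invariant
      Rx).
  exact: (orbit_exciting K_compact Phi_flow K_invariant Rx).
Qed.
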